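(* Let $(M,\omega)$ be a symplectic manifold of dimension $2n\ge4$ with a symplectic connection $\nabla$. Then the closed $2$-form $\omega^{J(M,\omega,\nabla)}$ on the twistor space $J(M,\omega)$ is of type $(1,1)$ for each of the almost complex structures $J^\pm_\nabla$ (i.e. $\operatorname{Tr}_{\mathbb R}(R^\nabla_p(jX,jY)\circ j)=\operatorname{Tr}_{\mathbb R}(R^\nabla_p(X,Y)\circ j)$ for all $p\in M$, $X,Y\in T_pM$, $j\in J(M,\omega)_p$) if and only if the curvature $R^\nabla$ is of Ricci type.
   Context: A symplectic connection is a torsion-free linear connection $\nabla$ with $\nabla\omega=0$. The twistor bundle $\pi\colon J(M,\omega)\to M$ has as fibre $J(M,\omega)_p$ over $p$ the set of complex structures $j$ on $T_pM$ with $\omega_p(jX,jY)=\omega_p(X,Y)$ and $\omega_p(X,jX)>0$ for $X\ne0$. Let $F(M,\omega)$ be the symplectic frame bundle (frames are linear symplectic isomorphisms $\xi\colon(\mathbb{R}^{2n},\Omega_0)\to(T_pM,\omega_p)$, $\Omega_0=\begin{pmatrix}0&I_n\\-I_n&0\end{pmatrix}$) and $\pi_1\colon F(M,\omega)\to J(M,\omega)$, $\xi\mapsto\xi\circ\tilde j_0\circ\xi^{-1}$, $\tilde j_0=\begin{pmatrix}0&-\mathrm{Id}_n\\\mathrm{Id}_n&0\end{pmatrix}$. The vertical space $\mathscr{V}_j=\operatorname{Ker}\pi_{*j}$ is identified with $\{S\in\operatorname{End}(T_pM): Sj+jS=0,\ \omega_p(SX,Y)+\omega_p(X,SY)=0\}$,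 $p=\pi(j)$. The horizontal space $\mathcal{H}^\nabla_j$ is the image under $\pi_{1*\xi}$ (any $\xi$ with $\pi_1(\xi)=j$) of the $\nabla$-horizontal subspace of $T_\xi F(M,\omega)$. Then $T_jJ(M,\omega)=\mathcal{H}^\nabla_j\oplus\mathscr{V}_j$ and $\mathcal{H}^\nabla_j\simeq T_{\pi(j)}M$ via $\pi_*$; $P^{\mathscr{V}}$ is the projection on $\mathscr{V}$ along $\mathcal{H}^\nabla$. Define $(J^\pm_\nabla)_j(S)=j\circ S$ for $S\in\mathscr{V}_j$, and $J^\pm_\nabla=\pm j$ on $\mathcal{H}^\nabla_j\simeq T_{\pi(j)}M$. The closed $2$-form is $$\omega^{J(M,\omega,\nabla)}_j(\Xi,\Xi')=-2\operatorname{Tr}_{\mathbb R}\big(R^\nabla_{\pi(j)}(\pi_{*j}\Xi,\pi_{*j}\Xi')\circ j\big)+i\operatorname{Tr}_{\mathbb C}\big([P^{\mathscr V}(\Xi),P^{\mathscr V}(\Xi')]\big),$$ where $\operatorname{Tr}_{\mathbb C}$ is the complex trace on $(T_{\pi(j)}M,j)$ and $R^\nabla(X,Y)=[\nabla_X,\nabla_Y]-\nabla_{[X,Y]}$. It is of type $(1,1)$ for $J^\pm_\nabla$ if $\omega^{J(M,\omega,\nabla)}(J^\pm_\nabla\Xi,J^\pm_\nabla\Xi')=\omega^{J(M,\omega,\nabla)}(\Xi,\Xi')$ for all $\Xi,\Xi'$. Let $Ric^\nabla(X,Y)=\operatorname{Tr}[Z\mapsto R^\nabla(X,Z)Y]$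 and $\omega(\rho^\nabla X,Y)=Ric^\nabla(X,Y)$. The curvature is of Ricci type if $R^\nabla=E^\nabla$, where $$E^\nabla(X,Y)Z=\tfrac{-1}{2(n+1)}\big[2\omega(X,Y)\rho^\nabla Z+\omega(X,Z)\rho^\nabla Y-\omega(Y,Z)\rho^\nabla X+Ric^\nabla(Y,Z)X-Ric^\nabla(X,Z)Y\big].$$ *)

(* Defs.v *)
From HB Require Import structures.
From mathcomp Require Import all_boot all_order all_algebra.
From mathcomp Require Import all_classical all_reals all_analysis.
From mathcomp Require Import complex.

Set Implicit Arguments.
Unset Strict Implicit.
Unset Printing Implicit Defensive.

Import Order.TTheory GRing.Theory Num.Theory numFieldNormedType.Exports.
Local Open Scope classical_set_scope.
Local Open Scope ring_scope.

(* A tensor field, connection or tangent vector on a manifold is given by its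
   components in each chart of the atlas, together with the compatibility of
   these components under change of charts.  The tangent space at a point of
   the domain of a chart c is thus read as the space of column vectors, its
   endomorphisms as square matrices acting by *m, and a point of the manifold
   is denoted by its image x in the open set [cimg c] of R^m. *)

Section Smooth.
Context {R : realType} {m : nat} {W : normedModType R}.

Fixpoint Ck_on (k : nat) (U : set 'cV[R]_m) (f : 'cV[R]_m -> W) : Prop :=
  match k with
  | 0 => forall x, U x -> {for x, continuous f}
  | k'.+1 => (forall x, U x -> differentiable f x) /\
             (forall v, Ck_on k' U (fun x => 'D_v f x))
  end.

Definition smooth_on (U : set 'cV[R]_m) (f : 'cV[R]_m -> W) : Prop :=
  forall k, Ck_on k U f.

End Smooth.

Record chart (R : realType) (m : nat) (M : topologicalType) := Chart {
  cdom : set M;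
  cmap : M -> 'cV[R]_m;
  cinv : 'cV[R]_m -> M }.

Section Charts.
Context {R : realType} {m : nat} {M : topologicalType}.
Implicit Types c : chart R m M.

Definition cimg c : set 'cV[R]_m := cmap c @` cdom c.

Definition is_chart c : Prop :=
  [/\ open (cdom c), open (cimg c),
      forall p, cdom c p -> cinv c (cmap c p) = p,
      forall p, cdom c p -> {for p, continuous (cmap c)} &
      forall x, cimg c x -> {for x, continuous (cinv c)}].

Definition overlap c c' : set 'cV[R]_m := cmap c @` (cdom c `&` cdom c').

Definition transition c c' : 'cV[R]_m -> 'cV[R]_m := cmap c' \o cinv c.

End Charts.

Record manifold (R : realType) (m : nat) := Manifold {
  mcarrier :> topologicalType;
  manifold_hausdorff : hausdorff_space mcarrier;
  manifold_second_countable : @second_countable mcarrier;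
  atlas : set (chart R m mcarrier);
  atlas_chart : forall c, atlas c -> is_chart c;
  atlas_cover : forall p, exists2 c, atlas c & cdom c p;
  atlas_smooth : forall c c', atlas c -> atlas c' ->
    smooth_on (overlap c c') (transition c c') }.

Definition form (R : realType) (m : nat) (w : 'M[R]_m) (u v : 'cV[R]_m) : R :=
  (u^T *m w *m v) 0 0.

(* [sform w c x] is the Gram matrix of the 2-form in the coordinate basis of
   the chart c at x. *)
Record symplectic_form (R : realType) (m : nat) (M : manifold R m) :=
  SymplecticForm {
  sform : chart R m M -> 'cV[R]_m -> 'M[R]_m;
  sform_smooth : forall c, atlas c -> smooth_on (cimg c) (sform c);
  sform_alt : forall c x, atlas c -> cimg c x ->
    forall u v, form (sform c x) u v = - form (sform c x) v u;
  sform_nondeg : forall c x, atlas c -> cimg c x ->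
    forall u, (forall v, form (sform c x) u v = 0) -> u = 0;
  sform_closed : forall c x, atlas c -> cimg c x -> forall u v w,
    'D_u (fun y => form (sform c y) v w) x
    + 'D_v (fun y => form (sform c y) w u) x
    + 'D_w (fun y => form (sform c y) u v) x = 0;
  sform_compat : forall c c' x, atlas c -> atlas c' -> overlap c c' x ->
    forall u v,
    form (sform c' (transition c c' x))
         ('D_u (transition c c') x) ('D_v (transition c c') x)
    = form (sform c x) u v }.

(* Here [G x u] is the matrix of w |-> Gamma_x(u, w), Gamma being the
   Christoffel symbols in a chart; [cov G X Y] is then nabla_X Y. *)
Definition cov (R : realType) (m : nat) (G : 'cV[R]_m -> 'cV[R]_m -> 'M[R]_m)
    (X Y : 'cV[R]_m -> 'cV[R]_m) : 'cV[R]_m -> 'cV[R]_m :=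
  fun x => 'D_(X x) Y x + G x (X x) *m Y x.

Definition bracket (R : realType) (m : nat) (X Y : 'cV[R]_m -> 'cV[R]_m) :
    'cV[R]_m -> 'cV[R]_m :=
  fun x => 'D_(X x) Y x - 'D_(Y x) X x.

(* X, in the chart c, and X', in the chart c', represent the same smooth vector
   field on the intersection of the two domains. *)
Definition same_field (R : realType) (m : nat) (M : topologicalType)
    (c c' : chart R m M) (X X' : 'cV[R]_m -> 'cV[R]_m) : Prop :=
  [/\ smooth_on (overlap c c') X, smooth_on (overlap c' c) X' &
      forall x, overlap c c' x ->
        X' (transition c c' x) = 'D_(X x) (transition c c') x].

Record connection (R : realType) (m : nat) (M : manifold R m) := Connection {
  christoffel : chart R m M -> 'cV[R]_m -> 'cV[R]_m -> 'M[R]_m;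
  christoffel_linear : forall c x, atlas c -> cimg c x ->
    forall (a : R) u v, christoffel c x (a *: u + v)
      = a *: christoffel c x u + christoffel c x v;
  christoffel_smooth : forall c, atlas c ->
    forall u, smooth_on (cimg c) (fun x => christoffel c x u);
  christoffel_compat : forall c c', atlas c -> atlas c' ->
    forall X Y X' Y', same_field c c' X X' -> same_field c c' Y Y' ->
    forall x, overlap c c' x ->
      cov (christoffel c') X' Y' (transition c c' x)
      = 'D_(cov (christoffel c) X Y x) (transition c c') x }.

Section SymplecticConnection.
Context {R : realType} {m : nat} {M : manifold R m}.
Implicit Types (w : symplectic_form M) (nabla : connection M).

Definition torsion_free nabla : Prop :=
  forall c X Y, atlas c -> smooth_on (cimg c) X -> smooth_on (cimg c) Y ->
  forall x, cimg c x ->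
    cov (christoffel nabla c) X Y x - cov (christoffel nabla c) Y X x
    - bracket X Y x = 0.

Definition preserves_form w nabla : Prop :=
  forall c X Y Z, atlas c -> smooth_on (cimg c) X ->
    smooth_on (cimg c) Y -> smooth_on (cimg c) Z ->
  forall x, cimg c x ->
    'D_(X x) (fun y => form (sform w c y) (Y y) (Z y)) x
    = form (sform w c x) (cov (christoffel nabla c) X Y x) (Z x)
      + form (sform w c x) (Y x) (cov (christoffel nabla c) X Z x).

Definition symplectic_connection w nabla : Prop :=
  torsion_free nabla /\ preserves_form w nabla.

Definition curvature_field nabla (c : chart R m M)
    (X Y Z : 'cV[R]_m -> 'cV[R]_m) : 'cV[R]_m -> 'cV[R]_m :=
  let D := cov (christoffel nabla c) in
  fun x => D X (D Y Z) x - D Y (D X Z) x - D (bracket X Y) Z x.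

(* R_x(u, v) z: by tensoriality, u, v and z may be extended by the vector
   fields with constant components in the chart c. *)
Definition curvature nabla (c : chart R m M) (x u v z : 'cV[R]_m) : 'cV[R]_m :=
  curvature_field nabla c (cst u) (cst v) (cst z) x.

Definition endo_mx (f : 'cV[R]_m -> 'cV[R]_m) : 'M[R]_m :=
  \matrix_(i, k) f (delta_mx k 0) i 0.

Definition curvature_mx nabla (c : chart R m M) (x u v : 'cV[R]_m) : 'M[R]_m :=
  endo_mx (curvature nabla c x u v).

Definition Ric nabla (c : chart R m M) (x u v : 'cV[R]_m) : R :=
  \tr (endo_mx (fun z => curvature nabla c x u z v)).

End SymplecticConnection.

Section RicciType.
Context {R : realType} {n : nat} {M : manifold R (n + n)}.
Variables (w : symplectic_form M) (nabla : connection M).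

Definition Ricci_part (c : chart R (n + n) M) (x : 'cV[R]_(n + n))
    (rho : 'M[R]_(n + n)) (X Y Z : 'cV[R]_(n + n)) : 'cV[R]_(n + n) :=
  let om := form (sform w c x) in
  let ric := Ric nabla c x in
  (- 1 / (2 * (n%:R + 1))) *:
    ((2 * om X Y) *: (rho *m Z) + om X Z *: (rho *m Y) - om Y Z *: (rho *m X)
     + ric Y Z *: X - ric X Z *: Y).

(* rho exists and is unique because the form is nondegenerate. *)
Definition Ricci_type : Prop :=
  forall c x, atlas c -> cimg c x -> exists rho : 'M[R]_(n + n),
    (forall X Y, form (sform w c x) (rho *m X) Y = Ric nabla c x X Y) /\
    (forall X Y Z, curvature nabla c x X Y Z = Ricci_part c x rho X Y Z).

End RicciType.

Section Twistor.
Context {R : realType} {n : nat} {M : manifold R (n + n)}.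
Variables (w : symplectic_form M) (nabla : connection M).
Implicit Types (c : chart R (n + n) M) (j S : 'M[R]_(n + n)).

(* Over the domain of a chart, the bundles of symplectic frames and of
   compatible complex structures are subsets of R^2n x M_2n(R): a pair (x, a)
   stands for the frame, or the complex structure, of matrix a at x. *)
Let E := ('cV[R]_(n + n) * 'M[R]_(n + n))%type.

Definition Omega0 : 'M[R]_(n + n) := block_mx 0 1%:M (- 1%:M) 0.
Definition j0 : 'M[R]_(n + n) := block_mx 0 (- 1%:M) 1%:M 0.

Definition frame_bundle c : set E := [set z | cimg c z.1 /\
  z.2 \in unitmx /\
  forall X Y, form (sform w c z.1) (z.2 *m X) (z.2 *m Y) = form Omega0 X Y].

Definition twistor c : set E := [set z | cimg c z.1 /\
  [/\ z.2 *m z.2 = - 1%:M,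
      forall X Y, form (sform w c z.1) (z.2 *m X) (z.2 *m Y)
                  = form (sform w c z.1) X Y &
      forall X, X != 0 -> 0 < form (sform w c z.1) X (z.2 *m X)]].

(* The tangent space at z of the twistor space, as a submanifold of E: the
   velocities at z of the curves which it contains. *)
Definition twistor_tangent c (z : E) : set E := [set Xi |
  exists gamma : R^o -> E,
    [/\ gamma 0 = z, \forall t \near (0 : R^o), twistor c (gamma t) &
        is_derive (0 : R^o) (1 : R^o) gamma Xi]].

(* In coordinates the projection pi is (x, j) |-> x, and pi_* is [fst]. *)
Definition vertical c (z : E) : set E :=
  [set Xi | twistor_tangent c z Xi /\ Xi.1 = 0].

(* xi |-> xi \o j0 \o xi^-1, defined on all linear frames. *)
Definition pi1 (z : E) : E := (z.1, z.2 *m j0 *m invmx z.2).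

(* Velocities of the moving frames which are parallel along their base curve. *)
Definition frame_horizontal c (xi : E) : set E :=
  [set eta | eta.2 + christoffel nabla c xi.1 eta.1 *m xi.2 = 0].

Definition horizontal c (z : E) : set E := [set Xi |
  exists xi, [/\ frame_bundle c xi, pi1 xi = z &
    exists2 eta, frame_horizontal c xi eta & 'D_eta pi1 xi = Xi]].

Definition PV c (z Xi : E) : E :=
  xget 0 [set v | vertical c z v /\ horizontal c z (Xi - v)].

Definition horizontal_lift c (z : E) (X : 'cV[R]_(n + n)) : E :=
  xget 0 [set h | horizontal c z h /\ h.1 = X].

(* eps = 1 gives J^+, eps = -1 gives J^-. *)
Definition Jnabla (eps : R) c (z Xi : E) : E :=
  horizontal_lift c z (eps *: (z.2 *m Xi.1)) + (0, z.2 *m (PV c z Xi).2).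

(* The complex trace of an endomorphism A which commutes with j: the columns of
   e form a basis of the complex vector space (R^2n, j), in which C is the
   matrix of A. *)
Definition complex_trace j (A : 'M[R]_(n + n)) : R[i] := xget 0 [set t |
  exists (e : 'M[R]_(n + n, n)) (C : 'M[R[i]]_n),
    [/\ row_mx e (j *m e) \in unitmx,
        A *m e = e *m map_mx (@complex.Re R) C
                 + j *m e *m map_mx (@complex.Im R) C &
        t = \tr C]].

Definition twistor_form c (z Xi Xi' : E) : R[i] :=
  let S := (PV c z Xi).2 in
  let S' := (PV c z Xi').2 in
  (- 2 * \tr (curvature_mx nabla c z.1 Xi.1 Xi'.1 *m z.2))%:C%C
  + 'i%C * complex_trace z.2 (S *m S' - S' *m S).

Definition type_1_1 (eps : R) : Prop :=
  forall c z, atlas c -> twistor c z ->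
  forall Xi Xi', twistor_tangent c z Xi -> twistor_tangent c z Xi' ->
    twistor_form c z (Jnabla eps c z Xi) (Jnabla eps c z Xi')
    = twistor_form c z Xi Xi'.

Definition trace_condition : Prop :=
  forall c x j, atlas c -> twistor c (x, j) ->
  forall X Y,
    \tr (curvature_mx nabla c x (j *m X) (j *m Y) *m j)
    = \tr (curvature_mx nabla c x X Y *m j).

End Twistor.

(* Main.v *)
Require Import Defs.
From HB Require Import structures.
From mathcomp Require Import all_boot all_order all_algebra.
From mathcomp Require Import all_classical all_reals all_analysis.
From mathcomp Require Import complex.
From mathcomp Require Import ring lra.
Import Defs.

Set Implicit Arguments.
Unset Strict Implicit.
Unset Printing Implicit Defensive.

Import Order.TTheory GRing.Theory Num.Theory numFieldNormedType.Exports.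
Local Open Scope ring_scope.

(** The proof is carried out in one chart, where all objects are matrices: [W]
    is the Gram matrix of the symplectic form, [G x u] the Christoffel matrix,
    and the curvature at [x] is [K u v = D_u G_v - D_v G_u + G_u G_v - G_v G_u].

    Reduction to the curvature.  At a point [(x, j)] of the twistor space, the
    horizontal space is the graph of [X |-> j G_X - G_X j], the vertical space
    consists of the [S] in the symplectic Lie algebra which anticommute with
    [j], and the tangent space is their direct sum.  Since [j] anticommutes
    with [S] and [S'], the commutator of [j S] and [j S'] equals that of [S]
    and [S'], so the second term of the 2-form is invariant under both almost
    complex structures.  On the horizontal part these act by [j] and [- j],
    and the sign disappears in the bilinear first term.  As every [X] is the
    projection of a tangent vector, type (1,1) for either structure is the
    trace condition ([twistor_form_Jnabla]).  The analytic point is that the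
    tangent space, defined by velocities of curves, contains everything that
    the linearized equations allow ([twistor_tangentI]).  The curves come from
    [symplectic_frame_curve]: a first order solution of the frame equation is
    corrected to an exact one by a square root of a matrix close to [1], which
    is the fixed point of a contraction.

    Symmetries of the curvature.  Absence of torsion gives the first Bianchi
    identity.  The curvature takes values in the symplectic Lie algebra because
    the second derivatives of [W] commute ([derive_comm]).

    Ricci type implies the trace condition by a direct computation, in which
    the symmetry of the Ricci tensor makes the trace invariant
    ([Ricci_trace_invariant]).

    Conversely, a compatible [j] exists at each point, and so do all its
    conjugates by the symplectic transvections [z |-> z + t w(v, z) v].  The
    trace condition for these conjugates is a polynomial identity in [t], whose
    leading coefficient says that [w(K(v, u) v, v)] is, for fixed [v],
    proportional to [w(v, u)] ([trace_invariance_transvection]).  Polarizing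
    this identity and taking a trace identifies the factor as a multiple of
    [Ric(v, v)] ([curv_cubic_Ric]).  Hence the difference of the curvature and
    its Ricci part is a tensor [D] with the symmetries of a curvature and with
    [D(x, y, x, x) = 0], and such a tensor vanishes
    ([curvature_like_eq0]). *)

(** * Bilinear forms given by matrices *)

Section Form.
Context {R : realType} {m : nat}.
Implicit Types (W A j : 'M[R]_m) (u v : 'cV[R]_m).

Lemma formDl W u u' v : form W (u + u') v = form W u v + form W u' v.
Proof. by rewrite /form linearD !mulmxDl mxE. Qed.

Lemma formDr W u v v' : form W u (v + v') = form W u v + form W u v'.
Proof. by rewrite /form mulmxDr mxE. Qed.

Lemma formZl W a u v : form W (a *: u) v = a * form W u v.
Proof. by rewrite /form linearZ /= -!scalemxAl mxE. Qed.

Lemma formZr W a u v : form W u (a *: v) = a * form W u v.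
Proof. by rewrite /form -scalemxAr mxE. Qed.

Lemma formNl W u v : form W (- u) v = - form W u v.
Proof. by rewrite -scaleN1r formZl mulN1r. Qed.

Lemma formNr W u v : form W u (- v) = - form W u v.
Proof. by rewrite -scaleN1r formZr mulN1r. Qed.

Lemma form0l W v : form W 0 v = 0.
Proof. by rewrite -(scale0r 0) formZl mul0r. Qed.

Definition formE := (formDl, formDr, formNl, formNr, formZl, formZr).

Lemma form_mull W A u v : form W (A *m u) v = form (A^T *m W) u v.
Proof. by rewrite /form trmx_mul !mulmxA. Qed.

Lemma form_mulr W A u v : form W u (A *m v) = form (W *m A) u v.
Proof. by rewrite /form !mulmxA. Qed.

Lemma formDmx W W' u v : form (W + W') u v = form W u v + form W' u v.
Proof. by rewrite /form mulmxDr mulmxDl mxE. Qed.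

Lemma formNmx W u v : form (- W) u v = - form W u v.
Proof. by rewrite /form mulmxN mulNmx mxE. Qed.

Lemma formZmx a W u v : form (a *: W) u v = a * form W u v.
Proof. by rewrite /form -scalemxAr -scalemxAl mxE. Qed.

Lemma form0mx u v : form 0 u v = 0.
Proof. by rewrite /form mulmx0 mul0mx mxE. Qed.

Lemma form_delta W i k : form W (delta_mx i 0) (delta_mx k 0) = W i k.
Proof. by rewrite /form trmx_delta -rowE -colE !mxE. Qed.

Lemma form_inj W W' : (forall u v, form W u v = form W' u v) -> W = W'.
Proof. by move=> e; apply/matrixP => i k; rewrite -!form_delta. Qed.

Lemma form_mx W u v : u^T *m W *m v = (form W u v)%:M.
Proof. by rewrite /form [LHS]mx11_scalar. Qed.

Lemma form_rank1 W u v z : u *m (v^T *m W) *m z = form W v z *: u.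
Proof. by rewrite -mulmxA form_mx mul_mx_scalar. Qed.

Lemma mxtrace_rank1 W u v : \tr (u *m (v^T *m W)) = form W v u.
Proof. by rewrite mxtrace_mulC form_mx mxtrace_scalar mulr1n. Qed.

Lemma form_colrow A B a b z y :
  form ((A *m a) *m (b^T *m B)) z y = form A z a * form B b y.
Proof.
rewrite /form !mulmxA -(mulmxA _ b^T B) -(mulmxA _ (b^T *m B) y).
by rewrite !mulmxA -mulmxA -mulmxA (mulmxA b^T) form_mx form_mx !mxE big_ord1
  !mxE !mulr1n.
Qed.

Lemma linear_delta (V : lmodType R) (f : 'cV[R]_m -> V) :
  (forall a u v, f (a *: u + v) = a *: f u + f v) ->
  forall u, f u = \sum_k u k 0 *: f (delta_mx k 0).
Proof.
move=> lf u.
have f0 : f 0 = 0 by have := lf (-1) 0 0; rewrite addr0 scaler0 scaleN1r addNr.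
have fZ a v : f (a *: v) = a *: f v by rewrite -[a *: v]addr0 lf f0 addr0.
have fD v v' : f (v + v') = f v + f v' by rewrite -[v in LHS]scale1r lf scale1r.
have {1}-> : u = \sum_k u k 0 *: delta_mx k 0.
  rewrite [LHS]matrix_sum_delta; apply: eq_bigr => k _; rewrite big_ord1.
  by congr (_ *: delta_mx _ _).
by rewrite (big_morph f fD f0); apply: eq_bigr => k _; rewrite fZ.
Qed.

Lemma endo_mxE (f : 'cV[R]_m -> 'cV[R]_m) :
  (forall a u v, f (a *: u + v) = a *: f u + f v) ->
  forall u, endo_mx f *m u = f u.
Proof.
move=> lf u; rewrite (linear_delta lf); apply/colP => i.
by rewrite summxE mxE; apply: eq_bigr => k _; rewrite !mxE mulrC.
Qed.

Lemma bilinear_form (B : 'cV[R]_m -> 'cV[R]_m -> R) :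
  (forall c u u' v, B (c *: u + u') v = c * B u v + B u' v) ->
  (forall c u v v', B u (c *: v + v') = c * B u v + B u v') ->
  exists q, forall u v, form q u v = B u v.
Proof.
move=> Bl Br; exists (\matrix_(i, k) B (delta_mx i 0) (delta_mx k 0)) => u v.
rewrite (linear_delta (V := R^o) (f := B u) (fun c v v' => Br c u v v')).
rewrite /form mxE; apply: eq_bigr => k _.
rewrite (linear_delta (V := R^o) (f := B^~ (delta_mx k 0))
  (fun c v v' => Bl c v v' _)) mxE mulrC; congr (_ * _).
by apply: eq_bigr => i _; rewrite !mxE.
Qed.

Lemma mulmx_ext A B : (forall u : 'cV[R]_m, A *m u = B *m u) -> A = B.
Proof.
by move=> e; apply/matrixP => i k; have /colP/(_ i) := e (delta_mx k 0);
  rewrite -!colE !mxE.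
Qed.

Lemma form_alt_tr W : (forall u v, form W u v = - form W v u) -> W^T = - W.
Proof.
move=> alt; apply/matrixP => i k.
by rewrite mxE -form_delta alt form_delta mxE.
Qed.

Lemma form_nondeg_unit W : (forall u, (forall v, form W u v = 0) -> u = 0) ->
  W \in unitmx.
Proof.
move=> nd; rewrite -row_free_unit -kermx_eq0; apply/eqP/row_matrixP => i.
rewrite row0; apply: trmx_inj; rewrite trmx0; apply: nd => v.
rewrite /form trmxK -row_mul mulmx_ker row0 mul0mx mxE.
by [].
Qed.

Lemma form_nondeg_inj W : W \in unitmx ->
  forall u u', (forall v, form W u v = form W u' v) -> u = u'.
Proof.
move=> Wu u u' e; apply: trmx_inj; apply: (can_inj (mulmxK Wu)).
apply/rowP => i; have := e (delta_mx i 0).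
by rewrite /form -!colE !mxE.
Qed.

End Form.

(** * Compatible complex structures *)

(** The fibre of the twistor bundle over a point where the symplectic form has
    Gram matrix [W]. *)
Definition compatible {R : realType} {m : nat} (W j : 'M[R]_m) : Prop :=
  [/\ j *m j = - 1%:M,
      forall X Y, form W (j *m X) (j *m Y) = form W X Y &
      forall X, X != 0 -> 0 < form W X (j *m X)].

(** A linear map carrying [W] to [W'] carries the twistor fibre of [W] to that of
    [W'].  The inverse [h] is kept explicit, since for transvections it is
    polynomial. *)
Lemma compatible_conj {R : realType} {m : nat} (W W' j g h : 'M[R]_m) :
  compatible W j -> g *m h = 1%:M ->
  (forall X Y, form W' (g *m X) (g *m Y) = form W X Y) ->
  compatible W' (g *m j *m h).
Proof.
move=> [jj jW jpos] gh gW.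
have hg : h *m g = 1%:M by apply: mulmx1C.
have gK X : g *m (h *m X) = X by rewrite mulmxA gh mul1mx.
split=> [|X Y|X X0].
- rewrite -!mulmxA (mulmxA h g) hg mul1mx (mulmxA j j) jj mulNmx mul1mx.
  by rewrite mulmxN gh.
- by rewrite -!mulmxA gW jW -gW !gK.
- rewrite -!mulmxA -{1}[X]gK gW; apply: jpos.
  by apply: contra_neq X0 => hX; rewrite -[X]gK hX mulmx0.
Qed.

Lemma compatible_trK {R : realType} {m : nat} (W j : 'M[R]_m) :
  compatible W j -> j^T *m W *m j = W.
Proof.
move=> [_ jW _]; apply: form_inj => a b.
by rewrite -form_mulr -form_mull jW.
Qed.

Lemma compatible_trl {R : realType} {m : nat} (W j : 'M[R]_m) :
  compatible W j -> j^T *m W = - (W *m j).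
Proof.
move=> cj; have [jj _ _] := cj.
by rewrite -[LHS]mulmx1 -[1%:M]opprK -jj mulmxN mulmxA (compatible_trK cj).
Qed.

(** The values at 0, 1, -1, 2 and -2 determine a polynomial of degree 4. *)
Lemma quartic_eq0 {R : realType} (c0 c1 c2 c3 c4 : R) :
  (forall t, c0 + c1 * t + c2 * t ^+ 2 + c3 * t ^+ 3 + c4 * t ^+ 4 = 0) ->
  c1 = 0 /\ c4 = 0.
Proof.
move=> P; have := (P 0, P 1, P (-1), P 2, P (-2)).
by case=> [[[[P0 P1] P2] P3] P4]; split; lra.
Qed.

(** * Algebra of the curvature at a point *)

(** Polarizing [D x y x x = 0] in [x] expresses [D x y x z] through
    [D y z x x]; the Bianchi identity then reads [2 * D y z x x = 0]. *)
Lemma curvature_like_eq0 {R : realType} {m : nat}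
    (D : 'cV[R]_m -> 'cV[R]_m -> 'cV[R]_m -> 'cV[R]_m -> R) :
  (forall u u' v z t, D (u + u') v z t = D u v z t + D u' v z t) ->
  (forall u v z z' t, D u v (z + z') t = D u v z t + D u v z' t) ->
  (forall u v z t, D u v z t = - D v u z t) ->
  (forall u v z t, D u v z t = D u v t z) ->
  (forall u v z t, D u v z t + D v z u t + D z u v t = 0) ->
  (forall x y, D x y x x = 0) -> forall u v z t, D u v z t = 0.
Proof.
move=> D1 D3 alt sym B H.
have N1 u v z t : D (- u) v z t = - D u v z t.
  have := D1 u (- u) v z t; rewrite subrr.
  by have := D1 0 0 v z t; rewrite addr0; lra.
have N3 u v z t : D u v (- z) t = - D u v z t.
  have := D3 u v z (- z) t; rewrite subrr.
  by have := D3 u v 0 0 t; rewrite addr0; lra.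
have D4 u v z t t' : D u v z (t + t') = D u v z t + D u v z t'.
  by rewrite sym D3 !(sym u v _ z).
have N4 u v z t : D u v z (- t) = - D u v z t.
  by rewrite sym N3 (sym u v t).
(* the part of degree 1 in [z] of [D (x + z) y (x + z) (x + z)], isolated from the
   part of degree 3 by comparing [z] with [- z] *)
have pol x y z : D z y x x + 2 * D x y x z = 0.
  have := H (x + z) y; rewrite !(D1, D3, D4) !H (sym x y z x) (sym z y z x).
  have := H (x - z) y; rewrite !(D1, N1, D3, N3, D4, N4) !H.
  rewrite (sym x y z x) (sym z y z x); lra.
have D0 y z x : D y z x x = 0.
  have := B x y z x; have := pol x y z; have := pol x z y.
  rewrite (alt z x y x) (sym x z y x) (sym x y z x) (alt y z); lra.
move=> u v z t; have := D0 u v (z + t); rewrite !(D3, D4) !D0 (sym u v t z); lra.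
Qed.

(** The algebraic symmetries of the curvature of a symplectic connection at a
    point. *)
Record symplectic_curvature {R : realType} {m : nat} (W : 'M[R]_m)
    (K : 'cV[R]_m -> 'cV[R]_m -> 'M[R]_m) : Prop := SymplecticCurvature {
  curv_linear : forall a u u' v, K (a *: u + u') v = a *: K u v + K u' v;
  curv_alt : forall u v, K u v = - K v u;
  curv_sp : forall u v a b,
    form W (K u v *m a) b = - form W a (K u v *m b);
  curv_Bianchi : forall u v z, K u v *m z + K v z *m u + K z u *m v = 0 }.

Section CurvatureAlgebra.
Context {R : realType} {m : nat}.
Variables (W : 'M[R]_m) (K : 'cV[R]_m -> 'cV[R]_m -> 'M[R]_m).
Hypothesis W_alt : forall u v, form W u v = - form W v u.
Hypothesis W_unit : W \in unitmx.
Hypothesis K_curv : symplectic_curvature W K.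

Local Notation om := (form W).
Implicit Types (u v x y z : 'cV[R]_m) (B : 'M[R]_m).

Let Ric u v := \tr (endo_mx (fun z => K u z *m v)).

Lemma curvDl u u' v : K (u + u') v = K u v + K u' v.
Proof. by rewrite -[u in LHS]scale1r (curv_linear K_curv) scale1r. Qed.

Lemma curv0l v : K 0 v = 0.
Proof. by apply: (addrI (K 0 v)); rewrite -curvDl !addr0. Qed.

Lemma curvZl (a : R) u v : K (a *: u) v = a *: K u v.
Proof. by rewrite -[a *: u]addr0 (curv_linear K_curv) curv0l addr0. Qed.

Lemma curvDr u v v' : K u (v + v') = K u v + K u v'.
Proof. by rewrite (curv_alt K_curv) curvDl opprD -!(curv_alt K_curv). Qed.

Lemma curvZr (a : R) u v : K u (a *: v) = a *: K u v.
Proof. by rewrite (curv_alt K_curv) curvZl -scalerN -(curv_alt K_curv). Qed.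

Lemma form_alt0 u : om u u = 0.
Proof. by have := W_alt u u; lra. Qed.

Lemma curv_sym u v z t : om (K u v *m z) t = om (K u v *m t) z.
Proof. by rewrite (curv_sp K_curv) W_alt opprK. Qed.

Let T u v B := \tr (K u v *m B).

Lemma trcDl u u' v B : T (u + u') v B = T u v B + T u' v B.
Proof. by rewrite /T curvDl mulmxDl mxtraceD. Qed.

Lemma trcDr u v v' B : T u (v + v') B = T u v B + T u v' B.
Proof. by rewrite /T curvDr mulmxDl mxtraceD. Qed.

Lemma trcZl a u v B : T (a *: u) v B = a * T u v B.
Proof. by rewrite /T curvZl -scalemxAl mxtraceZ. Qed.

Lemma trcZr a u v B : T u (a *: v) B = a * T u v B.
Proof. by rewrite /T curvZr -scalemxAl mxtraceZ. Qed.

Lemma trcDB u v B B' : T u v (B + B') = T u v B + T u v B'.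
Proof. by rewrite /T mulmxDr mxtraceD. Qed.

Lemma trcZB a u v B : T u v (a *: B) = a * T u v B.
Proof. by rewrite /T -scalemxAr mxtraceZ. Qed.

Lemma trc_alt u v B : T u v B = - T v u B.
Proof. by rewrite /T (curv_alt K_curv) mulNmx raddfN. Qed.

Lemma trc_rank1 u v z : T u v (z *m (z^T *m W)) = om z (K u v *m z).
Proof. by rewrite /T mulmxA mxtrace_rank1. Qed.

Lemma trcNB u v B : T u v (- B) = - T u v B.
Proof. by rewrite -scaleN1r trcZB mulN1r. Qed.

(** The trace condition is applied to [J t], the conjugate of [j] by the
    transvection [1 + t N] with [N z = w(v, z) v], and to the vectors
    [X = - j u] and [Y = j v].  Since [N N = 0] and [N j N = h N], both sides are
    polynomials in [t], and the coefficient of [t ^ 4] is, up to sign, the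
    difference of the two sides of the claim multiplied by [h ^ 2], where
    [h = w(v, j v)]. *)
Lemma trace_invariance_transvection j : compatible W j ->
  (forall j', compatible W j' -> forall X Y,
     T (j' *m X) (j' *m Y) j' = T X Y j') ->
  forall v u, om v (j *m v) * om v (K v u *m v)
              = om v u * om v (K v (j *m v) *m v).
Proof.
move=> cj inv v u; have [jj _ jpos] := cj.
pose N := v *m (v^T *m W).
have Nz z : N *m z = om v z *: v by apply: form_rank1.
pose h := om v (j *m v).
have NN : N *m N = 0.
  by rewrite /N mulmxA form_rank1 form_alt0 scale0r mul0mx.
have NjN : N *m j *m N = h *: N.
  by rewrite {2}/N -mulmxA (mulmxA j) mulmxA Nz -scalemxAl.
have TN y z : T y z N = om v (K y z *m v) by exact: trc_rank1.
clearbody N; pose J t := (1%:M + t *: N) *m j *m (1%:M - t *: N).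
have cJ t : compatible W (J t).
  apply: compatible_conj cj _ _.
    rewrite mulmxDl mul1mx mulmxBr mulmx1 -scalemxAl -scalemxAr NN !scaler0.
    by rewrite subr0 subrK.
  move=> X Y; rewrite !mulmxDl !mul1mx -!scalemxAl !Nz !formE.
  by rewrite form_alt0 (W_alt X v); ring.
pose P := N *m j - j *m N.
have JE t : J t = j + t *: P - (t ^+ 2 * h) *: N.
  rewrite /J /P mulmxDl mul1mx mulmxBr mulmx1 -!scalemxAl mulmxDl -!scalemxAr.
  rewrite -!scalemxAl NjN; move: (N *m j) (j *m N) => A B.
  by apply/matrixP => i k; rewrite !mxE; ring.
have Jz t z : J t *m z
    = j *m z + t *: (om v (j *m z) *: v - om v z *: (j *m v))
      - (t ^+ 2 * h * om v z) *: v.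
  rewrite JE /P mulmxBl mulmxDl -!scalemxAl mulmxBl -!mulmxA !Nz -scalemxAr.
  by rewrite scalerA.
pose X := - (j *m u).
have jX : j *m X = u by rewrite mulmxN mulmxA jj mulNmx mul1mx opprK.
have jjv : j *m (j *m v) = - v by rewrite mulmxA jj mulNmx mul1mx.
pose b := om v X; pose a := om v u; pose s := j *m v.
have JX t : J t *m X = u + (t * a - t ^+ 2 * h * b) *: v + (- (t * b)) *: s.
  by rewrite Jz jX -/a -/b -/s; apply/matrixP => i k; rewrite !mxE; ring.
have Js t : J t *m s = (- (1 + t ^+ 2 * h ^+ 2)) *: v + (- (t * h)) *: s.
  rewrite Jz -/s /s jjv -/s formNr form_alt0 -/h.
  by apply/matrixP => i k; rewrite !mxE; ring.
have := fun t => inv (J t) (cJ t) X s.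
have TvvB B : T v v B = 0 by have := trc_alt v v B; lra.
have TssB B : T s s B = 0 by have := trc_alt s s B; lra.
clearbody P; have TJ t y z : T y z (J t) = T y z j + t * T y z P - t ^+ 2 * h * T y z N.
  by rewrite JE !trcDB trcNB !trcZB; ring.
move=> E.
(* the difference of the two sides of the trace condition, sorted by powers of [t] *)
pose c0 := - T u v j - T X s j.
suff /quartic_eq0[_] : forall t,
    c0 + (- (h * T u s j + b * T v s j + T u v P) - T X s P) * t
  + (- h ^+ 2 * T u v j - a * h * T v s j + h * T u v N
     - (h * T u s P + b * T v s P) + h * T X s N) * t ^+ 2
  + (- h ^+ 2 * T u v P - a * h * T v s P
     + h * (h * T u s N + b * T v s N)) * t ^+ 3
  + (h ^+ 3 * T u v N + a * h ^+ 2 * T v s N) * t ^+ 4 = 0.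
  rewrite trc_alt !TN => h0; have [->|v0] := eqVneq v 0.
    by rewrite !form0l !mul0r.
  have {}h0 : h ^+ 2 * (a * om v (K v s *m v) - h * om v (K v u *m v)) = 0.
    by rewrite -[RHS]h0; ring.
  have hpos : 0 < h by apply: jpos.
  have /mulfI h2I : h ^+ 2 != 0 by rewrite expf_neq0 ?gt_eqF.
  by apply/esym/eqP; rewrite -subr_eq0; apply/eqP/h2I; rewrite mulr0.
move=> t; rewrite /c0.
have := E t; rewrite JX Js !(trcDl, trcDr, trcZl, trcZr) TvvB TssB.
rewrite (trc_alt s v) !TJ => /eqP; rewrite -subr_eq0 => /eqP <-; ring.
Qed.

Let Q u v a b := om (K u v *m a) b.

Lemma quadDs u v a b :
  [/\ forall u', Q (u + u') v a b = Q u v a b + Q u' v a b,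
      forall v', Q u (v + v') a b = Q u v a b + Q u v' a b,
      forall a', Q u v (a + a') b = Q u v a b + Q u v a' b &
      forall b', Q u v a (b + b') = Q u v a b + Q u v a b'].
Proof.
by split=> w; rewrite /Q ?curvDl ?curvDr ?mulmxDl ?mulmxDr formE.
Qed.

Lemma quadZs c u v a b :
  [/\ Q (c *: u) v a b = c * Q u v a b, Q u (c *: v) a b = c * Q u v a b,
      Q u v (c *: a) b = c * Q u v a b & Q u v a (c *: b) = c * Q u v a b].
Proof.
by split; rewrite /Q ?curvZl ?curvZr -?scalemxAl -?scalemxAr formE.
Qed.

Lemma curv_Bianchi_form u v a b :
  Q u v a b + Q v a u b + Q a u v b = 0.
Proof. by rewrite /Q -!formDl (curv_Bianchi K_curv) form0l. Qed.

(** The coefficient of [t] in the hypothesis at [x + t z]. *)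
Lemma curv_polarize :
  (forall x y y', om x y' * Q x y x x = om x y * Q x y' x x) ->
  forall x y y' z,
    om z y' * Q x y x x + om x y' * (Q z y x x + 2 * Q x y x z)
    = om z y * Q x y' x x + om x y * (Q z y' x x + 2 * Q x y' x z).
Proof.
move=> H x y y' z.
pose p2 y := Q z y x x + 2 * Q x y x z.
pose p3 y := 2 * Q z y x z + Q x y z z; pose p4 y := Q z y z z.
pose p1 y := Q x y x x.
have E t y0 : Q (x + t *: z) y0 (x + t *: z) (x + t *: z)
    = p1 y0 + p2 y0 * t + p3 y0 * t ^+ 2 + p4 y0 * t ^+ 3.
  have D1 u u' v a b : Q (u + u') v a b = Q u v a b + Q u' v a b.
    by case: (quadDs u v a b).
  have D3 u v a a' b : Q u v (a + a') b = Q u v a b + Q u v a' b.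
    by case: (quadDs u v a b).
  have D4 u v a b b' : Q u v a (b + b') = Q u v a b + Q u v a b'.
    by case: (quadDs u v a b).
  have Z1 c u v a b : Q (c *: u) v a b = c * Q u v a b by case: (quadZs c u v a b).
  have Z3 c u v a b : Q u v (c *: a) b = c * Q u v a b by case: (quadZs c u v a b).
  have Z4 c u v a b : Q u v a (c *: b) = c * Q u v a b by case: (quadZs c u v a b).
  rewrite !(D1, D3, D4, Z1, Z3, Z4) /p1 /p2 /p3 /p4 /Q.
  rewrite (curv_sym x y0 z x) (curv_sym z y0 z x); ring.
apply/eqP; rewrite -subr_eq0; apply/eqP; rewrite -/(p1 y) -/(p1 y') -/(p2 y) -/(p2 y').
pose c0 := om x y' * p1 y - om x y * p1 y'.
pose c2 := om z y' * p2 y + om x y' * p3 y - (om z y * p2 y' + om x y * p3 y').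
pose c3 := om z y' * p3 y + om x y' * p4 y - (om z y * p3 y' + om x y * p4 y').
pose c4 := om z y' * p4 y - om z y * p4 y'.
apply: (proj1 (@quartic_eq0 _ c0 _ c2 c3 c4 _)) => t.
have /eqP := H (x + t *: z) y y'; rewrite -subr_eq0 => /eqP <-.
by rewrite !E !formE /c0 /c2 /c3 /c4; ring.
Qed.

(** By hypothesis [Q x y x x] is a multiple of [om x y] for each [x]; the factor
    is found by a trace.  The operator [L z = K(x, z) x] has trace [Ric x x], and
    by the Bianchi identity the polarized hypothesis is expressed by [L] alone.
    Read as a bilinear form in [(z, y)], it is the vanishing of a matrix [M], and
    the trace of [W^-1 M] is the formula. *)
Lemma curv_cubic_Ric :
  (forall x y y', om x y' * Q x y x x = om x y * Q x y' x x) ->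
  forall x y, (m%:R + 2) * Q x y x x = - 4 * om x y * Ric x x.
Proof.
move=> H x y'; pose L := endo_mx (fun z => K x z *m x).
have LE z : L *m z = K x z *m x.
  by apply: endo_mxE => a u v; rewrite curvDr curvZr mulmxDl -scalemxAl.
have QL y z : Q x y x z = - om z (L *m y) by rewrite /Q -LE W_alt.
have dQ y z : Q z y x x + 2 * Q x y x z
    = - (3 * om z (L *m y) + om (L *m z) y).
  have := curv_Bianchi_form z y x x; have := QL y z.
  have : Q x z y x = om (L *m z) y by rewrite /Q curv_sym LE.
  have : Q y x z x = - Q x y x z.
    by rewrite /Q (curv_alt K_curv) mulNmx formNl curv_sym.
  lra.
pose c := om x y'; pose d := om x (L *m y').
pose S := 3 *: (W *m L) + L^T *m W.
pose M := d *: W - c *: S - (W *m y') *m (x^T *m (W *m L))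
          + (S *m y') *m (x^T *m W).
have SE z y : form S z y = 3 * om z (L *m y) + om (L *m z) y.
  by rewrite formDmx formZmx -form_mulr -form_mull.
have M0 : M = 0.
  apply: form_inj => z y; rewrite /M !formDmx !formNmx !formZmx !form_colrow.
  rewrite !SE -form_mulr; have := curv_polarize H x y y' z.
  by rewrite !dQ !QL -/c -/d form0mx; lra.
have Lx : L *m x = 0.
  rewrite LE; have /eqP := curv_alt K_curv x x.
  rewrite -addr_eq0 -mulr2n -scaler_nat scaler_eq0 pnatr_eq0 /= => /eqP ->.
  by rewrite mul0mx.
have trLt : \tr (invmx W *m (L^T *m W)) = \tr L.
  by rewrite mxtrace_mulC mulmxK ?mxtrace_tr.
have trSy : \tr (invmx W *m ((S *m y') *m (x^T *m W))) = 3 * d.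
  rewrite mxtrace_mulC -!mulmxA mulmxV // mulmx1 mulmxA.
  rewrite mxtrace_mulC mulmxA form_mx mxtrace_scalar mulr1n SE Lx form0l addr0 -/d.
  by [].
have : \tr (invmx W *m M) = 0 by rewrite M0 mulmx0 mxtrace0.
rewrite /M !(mulmxDr, mulmxN) !mxtraceD !raddfN /= trSy -!scalemxAr !mxtraceZ.
rewrite mulVmx // mxtrace1 /S mulmxDr -scalemxAr mxtraceD mxtraceZ trLt mulKmx //.
have -> : \tr (invmx W *m (W *m y' *m (x^T *m (W *m L)))) = d.
  rewrite -(mulmxA W) mulKmx // mxtrace_mulC form_mx mxtrace_scalar mulr1n.
  by rewrite -form_mulr.
by rewrite QL -/d -/c -[Ric x x]/(\tr L); lra.
Qed.

(** An endomorphism in the symplectic Lie algebra is similar to minus its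
    transpose. *)
Lemma trace_curv u v : \tr (K u v) = 0.
Proof.
suff e : K u v = - (invmx W *m ((K u v)^T *m W)).
  have : \tr (K u v) = - \tr (K u v).
    by rewrite {1}e raddfN /= mxtrace_mulC mulmxK // mxtrace_tr.
  lra.
rewrite -mulmxN; apply: (canRL (mulKmx W_unit)); apply: form_inj => a b.
by rewrite formNmx -(form_mulr W) -(form_mull W) (curv_sp K_curv) opprK.
Qed.

(** By the Bianchi identity the antisymmetric part of [Ric] is a trace of [K]. *)
Lemma Ric_sym u v : Ric u v = Ric v u.
Proof.
apply/eqP; rewrite -subr_eq0 -raddfB /=; apply/eqP; rewrite -[RHS](trace_curv u v).
congr (\tr _); apply/matrixP => i k; pose e := delta_mx k 0 : 'cV[R]_m.
transitivity ((K u e *m v - K v e *m u) i 0); first by rewrite /endo_mx !mxE.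
suff -> : K u e *m v - K v e *m u = K u v *m e by rewrite -colE mxE.
apply/eqP; rewrite eq_sym -subr_eq0 -(curv_Bianchi K_curv u v e).
by rewrite (curv_alt K_curv e u) mulNmx opprB addrA (addrAC _ (K v e *m u)).
Qed.

Lemma Ric_form : exists q, forall u v, form q u v = Ric u v.
Proof.
have lin c u u' v : Ric (c *: u + u') v = c * Ric u v + Ric u' v.
  rewrite /Ric -mxtraceZ -mxtraceD; congr (\tr _); apply/matrixP => i k.
  pose e := delta_mx k 0 : 'cV[R]_m.
  transitivity ((c *: (K u e *m v) + K u' e *m v) i 0).
    by rewrite [LHS]mxE (curv_linear K_curv) mulmxDl -scalemxAl.
  by rewrite /endo_mx !mxE.
apply: bilinear_form => // c u v v'.
by rewrite Ric_sym lin !(Ric_sym u).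
Qed.

(** The operator [E] of the definition of Ricci type in dimension [m = 2 n], for
    which [2 (n + 1)] is [m + 2]. *)
Definition Ricci_tensor (rho : 'M[R]_m) X Y Z : 'cV[R]_m :=
  (- 1 / (m%:R + 2)) *:
    ((2 * om X Y) *: (rho *m Z) + om X Z *: (rho *m Y) - om Y Z *: (rho *m X)
     + Ric Y Z *: X - Ric X Z *: Y).

(** [curvature_like_eq0] applied to the difference of the curvature and its Ricci
    part: [curv_cubic_Ric] gives the hypothesis [D x y x x = 0]. *)
Lemma Ricci_of_cubic rho :
  (forall X Y, om (rho *m X) Y = Ric X Y) ->
  (forall x y y', om x y' * Q x y x x = om x y * Q x y' x x) ->
  forall X Y Z, K X Y *m Z = Ricci_tensor rho X Y Z.
Proof.
move=> rhoE H; pose k : R := - 1 / (m%:R + 2).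
have m2 : (m%:R + 2 : R) != 0 by rewrite gt_eqF // ltr_wpDl.
have RE X Y Z t : om (Ricci_tensor rho X Y Z) t
    = k * (2 * om X Y * Ric Z t + om X Z * Ric Y t - om Y Z * Ric X t
           + Ric Y Z * om X t - Ric X Z * om Y t).
  by rewrite /Ricci_tensor !formE !rhoE.
have RD u u' v : Ric (u + u') v = Ric u v + Ric u' v.
  by rewrite -!rhoE mulmxDr formE.
have RDr u v v' : Ric u (v + v') = Ric u v + Ric u v' by rewrite -!rhoE formE.
suff D0 X Y Z t : om (K X Y *m Z) t - om (Ricci_tensor rho X Y Z) t = 0.
  move=> X Y Z; apply: (form_nondeg_inj W_unit) => t.
  by have := D0 X Y Z t => /eqP; rewrite subr_eq0 => /eqP.
move: X Y Z t; apply: curvature_like_eq0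
  => [u u' v z t|u v z z' t|u v z t|u v z t|u v z t|x y] /=.
- by rewrite !RE curvDl mulmxDl !formE !RD; ring.
- by rewrite !RE mulmxDr !formE !RD !RDr; ring.
- by rewrite !RE (curv_alt K_curv) mulNmx formE (W_alt v u); ring.
- by rewrite !RE curv_sym (Ric_sym t z); ring.
- rewrite !RE; have := curv_Bianchi_form u v z t; rewrite /Q.
  rewrite (Ric_sym v u) (Ric_sym z v) (Ric_sym u z).
  rewrite (W_alt v u) (W_alt z v) (W_alt u z) => E.
  rewrite -[RHS]E; ring.
- rewrite -/(Q x y x x) RE form_alt0 (W_alt y x) (Ric_sym y x).
  apply: (mulfI m2); rewrite mulr0 mulrBr (curv_cubic_Ric H) /k; field.
  by rewrite m2.
Qed.

(** Composing [K X Y] with [j], all terms but the first have rank one, so that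
    their traces are values of [Ric]; these sum up to
    [2 (Ric Y (j X) - Ric X (j Y))], which is invariant because [Ric] is symmetric
    and [j ^ 2 = - 1]. *)
Lemma Ricci_trace_invariant rho j :
  (forall X Y, om (rho *m X) Y = Ric X Y) ->
  (forall X Y Z, K X Y *m Z = Ricci_tensor rho X Y Z) ->
  compatible W j -> forall X Y, T (j *m X) (j *m Y) j = T X Y j.
Proof.
move=> rhoE KE [jj jW _]; pose k : R := - 1 / (m%:R + 2).
have qE X Y : form (rho^T *m W) X Y = Ric X Y by rewrite -rhoE form_mull.
have TE X Y : T X Y j = k * (2 * om X Y * \tr (rho *m j) + om X (j *m (rho *m Y))
    - om Y (j *m (rho *m X)) + Ric Y (j *m X) - Ric X (j *m Y)).
  have KXY : K X Y = k *: ((2 * om X Y) *: rho + (rho *m Y) *m (X^T *m W)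
     - (rho *m X) *m (Y^T *m W) + X *m (Y^T *m (rho^T *m W))
     - Y *m (X^T *m (rho^T *m W))).
    apply: mulmx_ext => Z; rewrite KE /Ricci_tensor -scalemxAl -/k.
    by rewrite !(mulmxDl, mulNmx) -scalemxAl !form_rank1 !qE.
  have tr1 P x A : \tr (P *m (x^T *m A) *m j) = form A x (j *m P).
    by rewrite mxtrace_mulC (mulmxA j P) mxtrace_rank1.
  rewrite /T KXY -scalemxAl mxtraceZ !(mulmxDl, mulNmx) !mxtraceD !raddfN /=.
  by rewrite !tr1 -scalemxAl mxtraceZ !qE.
have omj u v : om (j *m u) v = - om u (j *m v).
  by rewrite -[LHS]jW mulmxA jj mulNmx mul1mx formNl.
have rhoE' x y : om x (rho *m y) = - Ric y x by rewrite W_alt rhoE.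
have RicNr x y : Ric x (- y) = - Ric x y by rewrite -!rhoE formNr.
have jjx x : j *m (j *m x) = - x by rewrite mulmxA jj mulNmx mul1mx.
have omjrho x y : om x (j *m (rho *m y)) = Ric y (j *m x).
  by rewrite -[LHS]opprK -omj rhoE' opprK.
move=> X Y; rewrite !TE jW !omjrho !jjx !RicNr.
by rewrite (Ric_sym (j *m Y)) (Ric_sym (j *m X)); ring.
Qed.

Lemma trace_invariant_Ricci rho j :
  (forall X Y, om (rho *m X) Y = Ric X Y) -> compatible W j ->
  (forall j', compatible W j' -> forall X Y,
     T (j' *m X) (j' *m Y) j' = T X Y j') ->
  forall X Y Z, K X Y *m Z = Ricci_tensor rho X Y Z.
Proof.
move=> rhoE cj inv; apply: Ricci_of_cubic => // x y y'.
have [->|x0] := eqVneq x 0; first by rewrite !form0l !mul0r.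
have [_ _ /(_ x x0) h0] := cj.
have tr u : om x (j *m x) * Q x u x x = om x u * Q x (j *m x) x x.
  have := trace_invariance_transvection cj inv x u.
  by rewrite !(W_alt x (_ *m x)) /Q; lra.
have /mulfI hI : om x (j *m x) != 0 by rewrite gt_eqF.
by apply: hI; rewrite mulrCA tr [in RHS]mulrCA tr; ring.
Qed.

End CurvatureAlgebra.

(** * Symplectic and unitary frames *)

Section SymplecticFrames.
Context {R : realType} {m : nat}.
Variable W : 'M[R]_m.
Hypothesis W_tr : W^T = - W.

Let W_alt u v : form W u v = - form W v u.
Proof.
rewrite /form -[in LHS](trmxK W) W_tr -[in LHS](trmxK v) -!trmx_mul mxE.
by rewrite mulNmx mulmxN mulmxA mxE.
Qed.

(** Partial symplectic bases: the columns of [e] and of [f] span isotropic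
    subspaces and are dual to each other. *)
Definition symplectic_family k (e f : 'M[R]_(m, k)) :=
  [/\ e^T *m W *m e = 0, f^T *m W *m f = 0 & e^T *m W *m f = 1%:M].

Lemma form_tr_eq0 k l (a : 'M[R]_(m, k)) (b : 'M[R]_(m, l)) :
  a^T *m W *m b = 0 -> b^T *m W *m a = 0.
Proof.
move=> ab; apply: trmx_inj; rewrite !trmx_mul trmxK W_tr mulNmx mulmxN mulmxA.
by rewrite ab oppr0 trmx0.
Qed.

Lemma form_self (v : 'cV[R]_m) : v^T *m W *m v = 0.
Proof.
have E := W_alt v v; rewrite form_mx.
have -> : form W v v = 0 by lra.
by rewrite raddf0.
Qed.

Lemma symplectic_family_extend k (e f : 'M[R]_(m, k)) (v u : 'cV[R]_m) :
  symplectic_family e f -> e^T *m W *m v = 0 -> f^T *m W *m v = 0 ->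
  e^T *m W *m u = 0 -> f^T *m W *m u = 0 -> form W v u = 1 ->
  symplectic_family (row_mx v e) (row_mx u f).
Proof.
move=> [ee ff ef] ev fv eu fu vu; split.
- rewrite tr_row_mx mul_col_mx mul_col_row ee form_self ev (form_tr_eq0 ev).
  exact: block_mx0.
- rewrite tr_row_mx mul_col_mx mul_col_row ff form_self fu (form_tr_eq0 fu).
  exact: block_mx0.
- rewrite tr_row_mx mul_col_mx mul_col_row ef eu (form_tr_eq0 fv) form_mx vu.
  by rewrite -scalar_mx_block.
Qed.

(** There are fewer than [m] linear conditions on a vector with [m] coordinates. *)
Lemma exists_orthogonal k (e f : 'M[R]_(m, k)) : (k + k < m)%N ->
  exists v : 'cV[R]_m, [/\ v != 0, e^T *m W *m v = 0 & f^T *m W *m v = 0].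
Proof.
move=> km; pose A := col_mx (e^T *m W) (f^T *m W).
have : kermx A^T != 0.
  rewrite kermx_eq0 /row_free ltn_eqF // (leq_ltn_trans _ km) //.
  exact: rank_leq_col.
case/rowV0Pn => r /sub_kermxP rA r0; exists r^T.
have : A *m r^T = 0 by rewrite -[A]trmxK -trmx_mul rA trmx0.
rewrite mul_col_mx => /eqP; rewrite col_mx_eq0 => /andP[/eqP ev /eqP fv].
by split => //; rewrite -(inj_eq trmx_inj) trmxK trmx0.
Qed.

(** Symplectic Gram-Schmidt: a vector [v] orthogonal to the family is completed by
    any [u0] with [w(v, u0)] nonzero, after projecting [u0] off the family. *)
Lemma exists_symplectic_family : W \in unitmx ->
  forall k, (k + k <= m)%N -> exists e f : 'M[R]_(m, k), symplectic_family e f.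
Proof.
move=> Wu; elim=> [|k IH] km.
  by exists 0, 0; split; apply/matrixP => - [].
have {}km : (k + k < m)%N by apply: leq_trans km; rewrite addSn addnS ltnW.
have [e [f ef]] := IH (ltnW km); have [v [v0 ev fv]] := exists_orthogonal e f km.
have [u0 vu0] : exists u, form W v u != 0.
  apply/not_existsP => H; move/eqP: v0; apply; apply: (form_nondeg_inj Wu) => u.
  by rewrite form0l; apply/eqP/negPn/negP.
have [ee ff efI] := ef.
have fe : f^T *m W *m e = - 1%:M.
  apply: trmx_inj; rewrite !trmx_mul trmxK W_tr mulNmx mulmxN mulmxA efI.
  by rewrite linearN /= trmx1.
pose u1 := u0 + e *m (f^T *m W *m u0) - f *m (e^T *m W *m u0).
have eu1 : e^T *m W *m u1 = 0.
  rewrite !mulmxDr mulmxN !(mulmxA (e^T *m W)) ee efI mul0mx mul1mx addr0.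
  by rewrite subrr.
have fu1 : f^T *m W *m u1 = 0.
  rewrite !mulmxDr mulmxN !(mulmxA (f^T *m W)) ff fe mul0mx mulNmx mul1mx.
  by rewrite subrr oppr0 addr0.
have vu1 : form W v u1 = form W v u0.
  rewrite /form !mulmxDr mulmxN !(mulmxA (v^T *m W)) (form_tr_eq0 ev).
  by rewrite (form_tr_eq0 fv) !mul0mx oppr0 !addr0.
exists (row_mx v e), (row_mx ((form W v u0)^-1 *: u1) f).
apply: symplectic_family_extend => //.
- by rewrite -scalemxAr eu1 scaler0.
- by rewrite -scalemxAr fu1 scaler0.
- by rewrite formZr vu1 mulVf.
Qed.

(** Gram-Schmidt for the Hermitian form attached to [W] and [j]: here the partner
    of a new vector [v] of length 1 is [j v]. *)
Lemma exists_unitary_family j : compatible W j ->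
  forall k, (k + k <= m)%N -> exists e : 'M[R]_(m, k), symplectic_family e (j *m e).
Proof.
move=> cj; have [_ _ jpos] := cj.
have jtW := compatible_trK cj; have jtW' := compatible_trl cj.
elim=> [|k IH] km.
  by exists 0; split; apply/matrixP => - [].
have {}km : (k + k < m)%N by apply: leq_trans km; rewrite addSn addnS ltnW.
have [e ef] := IH (ltnW km); have [v [v0 ev fv]] := exists_orthogonal e (j *m e) km.
pose h := form W v (j *m v); have h0 : 0 < h by apply: jpos.
pose c := (Num.sqrt h)^-1.
have cc : c * c * h = 1.
  by rewrite /c -invfM -expr2 sqr_sqrtr ?ltW // mulVf ?gt_eqF.
have ejv : e^T *m W *m (j *m v) = 0.
  apply/eqP; rewrite -oppr_eq0 mulmxA -(mulmxA e^T) -mulNmx -mulmxN -jtW'.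
  by rewrite mulmxA -trmx_mul fv.
have fjv : (j *m e)^T *m W *m (j *m v) = 0.
  by rewrite trmx_mul !mulmxA -(mulmxA e^T) -(mulmxA e^T) jtW ev.
suff : symplectic_family (row_mx (c *: v) e) (row_mx (c *: (j *m v)) (j *m e)).
  by rewrite scalemxAr -mul_mx_row => ?; exists (row_mx (c *: v) e).
apply: symplectic_family_extend => //; rewrite -?scalemxAr.
- by rewrite ev scaler0.
- by rewrite fv scaler0.
- by rewrite ejv scaler0.
- by rewrite fjv scaler0.
- by rewrite formZl formZr mulrA.
Qed.

End SymplecticFrames.

Section Frames.
Context {R : realType} {n : nat}.
Variable W : 'M[R]_(n + n).
Hypothesis W_tr : W^T = - W.
Local Notation J0 := (j0 : 'M[R]_(n + n)).

Lemma frame_of_family (e f : 'M[R]_(n + n, n)) : symplectic_family W e f ->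
  (row_mx e f)^T *m W *m row_mx e f = Omega0.
Proof.
move=> [ee ff ef]; rewrite tr_row_mx mul_col_mx mul_col_row ee ff ef.
congr (block_mx _ _ _ _); apply: trmx_inj.
by rewrite !trmx_mul trmxK W_tr mulNmx mulmxN mulmxA ef linearN /= trmx1.
Qed.

Lemma frame_unit (a : 'M[R]_(n + n)) : a^T *m W *m a = Omega0 -> a \in unitmx.
Proof.
move=> aW; pose Oi : 'M[R]_(n + n) := block_mx 0 (- 1%:M) 1%:M 0.
suff : Oi *m (a^T *m W) *m a = 1%:M by case/mulmx1_unit.
rewrite -mulmxA aW mulmx_block !mul0mx !mulmx0 !mul1mx !addr0 !add0r mulNmx.
by rewrite mul1mx opprK -scalar_mx_block.
Qed.

Lemma j0_sq : J0 *m J0 = - 1%:M.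
Proof.
rewrite mulmx_block !mul0mx !mulmx0 mul1mx mulmx1 !addr0 !add0r.
by rewrite [in RHS]scalar_mx_block opp_block_mx !oppr0.
Qed.

Lemma j0_Omega0 : compatible Omega0 J0.
Proof.
have E X Y : form Omega0 X Y = ((usubmx X)^T *m dsubmx Y - (dsubmx X)^T *m usubmx Y) 0 0.
  rewrite /form -{1}[X]vsubmxK -{1}[Y]vsubmxK tr_col_mx mul_row_block.
  by rewrite !mulmx0 !mulmxN !mulmx1 addr0 add0r mul_row_col mulNmx addrC.
have jE (X : 'cV[R]_(n + n)) : J0 *m X = col_mx (- dsubmx X) (usubmx X).
  rewrite -{1}[X]vsubmxK mul_block_col !mul0mx mul1mx add0r addr0 mulNmx.
  by rewrite mul1mx.
split=> [|X Y|X X0]; first exact: j0_sq.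
  rewrite !E !jE !col_mxKu !col_mxKd linearN /= mulNmx mulmxN opprK addrC.
  by [].
rewrite E jE col_mxKu col_mxKd mulmxN opprK mxE.
have sq k (v : 'cV[R]_k) : (v^T *m v) 0 0 = \sum_i v i 0 ^+ 2.
  by rewrite mxE; apply: eq_bigr => i _; rewrite mxE expr2.
have sq0 k (v : 'cV[R]_k) : 0 <= (v^T *m v) 0 0.
  by rewrite sq sumr_ge0 // => i _; rewrite sqr_ge0.
rewrite lt_def addr_ge0 // andbT paddr_eq0 //; apply: contra_neqN X0.
have z k (v : 'cV[R]_k) : (v^T *m v) 0 0 == 0 -> v = 0.
  rewrite sq psumr_eq0 => [/allP v0|i _]; last exact: sqr_ge0.
  apply/colP => i; have := v0 i (mem_index_enum i).
  by rewrite /= sqrf_eq0 mxE => /eqP.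
by case/andP => /z u0 /z d0; rewrite -[X]vsubmxK u0 d0 col_mx0.
Qed.

Lemma frame_compatible (a : 'M[R]_(n + n)) : a^T *m W *m a = Omega0 ->
  compatible W (a *m j0 *m invmx a).
Proof.
move=> aW; apply: compatible_conj j0_Omega0 _ _.
  by rewrite mulmxV // (frame_unit aW).
by move=> X Y; rewrite form_mull form_mulr aW.
Qed.

Lemma exists_symplectic_frame : W \in unitmx ->
  exists a : 'M[R]_(n + n), a^T *m W *m a = Omega0.
Proof.
move=> Wu; have [e [f ef]] := exists_symplectic_family W_tr Wu (leqnn (n + n)).
by exists (row_mx e f); apply: frame_of_family.
Qed.

Lemma exists_unitary_frame j : compatible W j ->
  exists2 a : 'M[R]_(n + n), a^T *m W *m a = Omega0 & a *m j0 = j *m a.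
Proof.
move=> cj; have [e ef] := exists_unitary_family W_tr cj (leqnn (n + n)).
exists (row_mx e (j *m e)); first exact: frame_of_family.
have [jj _ _] := cj; rewrite mul_row_block mul_mx_row mulmxA jj.
by rewrite !mulmx0 !mulmxN !mulmx1 add0r addr0 mulNmx mul1mx.
Qed.

End Frames.

(** * Derivatives of matrix-valued functions *)

Section MatrixCalculus.
Context {R : realType} {V : normedModType R}.
Implicit Types (x v : V).

Lemma is_derive_mxP p q (A : V -> 'M[R]_(p, q)) x v dA :
  is_derive x v A dA <->
  forall i j, is_derive x v (fun y => A y i j) (dA i j).
Proof.
split=> [[dA1 <-] i j|H].
  rewrite (derive_mx dA1) mxE; apply: derivableP.
  by move/derivable_mxP: dA1.
have dA1 : derivable A x v by apply/derivable_mxP => i j; have [] := H i j.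
apply: DeriveDef => //; rewrite (derive_mx dA1); apply/matrixP => i j.
by rewrite mxE; have [_ ->] := H i j.
Qed.

Lemma is_derive_mulmx p q r (A : V -> 'M[R]_(p, q)) (B : V -> 'M[R]_(q, r))
    x v dA dB :
  is_derive x v A dA -> is_derive x v B dB ->
  is_derive x v (fun y => A y *m B y) (dA *m B x + A x *m dB).
Proof.
move=> /is_derive_mxP hA /is_derive_mxP hB; apply/is_derive_mxP => i k.
have -> : (fun y => (A y *m B y) i k)
    = \sum_(l < q) ((fun y => A y i l) * (fun y => B y l k)).
  by apply/funext => y; rewrite mxE fct_sumE.
apply: is_derive_eq.
rewrite mxE [in RHS]mxE [X in _ + X]mxE -big_split; apply: eq_bigr => l _ /=.
by rewrite /GRing.scale /= addrC (mulrC (B x l k)).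
Qed.

Lemma is_derive_trmx p q (A : V -> 'M[R]_(p, q)) x v dA :
  is_derive x v A dA -> is_derive x v (fun y => (A y)^T) dA^T.
Proof.
move=> /is_derive_mxP hA; apply/is_derive_mxP => i k.
have -> : (fun y => (A y)^T i k) = (fun y => A y k i).
  by apply/funext => y; rewrite mxE.
by rewrite mxE.
Qed.

Lemma is_derive_const (W : normedModType R) (c : W) x v : is_derive x v (fun=> c) 0.
Proof. exact: is_derive_cst. Qed.

Lemma is_derive_mulmxl p q r (A : 'M[R]_(p, q)) (B : V -> 'M[R]_(q, r)) x v dB :
  is_derive x v B dB -> is_derive x v (fun y => A *m B y) (A *m dB).
Proof.
move=> hB; rewrite -[A *m dB]add0r -[0](mul0mx _ (B x)).
by apply: (is_derive_mulmx (A := fun=> A)).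
Qed.

Lemma is_derive_mulmxr p q r (B : 'M[R]_(q, r)) (A : V -> 'M[R]_(p, q)) x v dA :
  is_derive x v A dA -> is_derive x v (fun y => A y *m B) (dA *m B).
Proof.
move=> hA; rewrite -[dA *m B]addr0 -(mulmx0 _ (A x)).
by apply: (is_derive_mulmx (B := fun=> B)).
Qed.

Lemma is_derive_form m (W : V -> 'M[R]_m) x v dW a b :
  is_derive x v W dW -> is_derive x v (fun y => form (W y) a b) (form dW a b).
Proof.
move=> hW; have : is_derive x v (fun y => a^T *m W y *m b) (a^T *m dW *m b).
  by apply: is_derive_mulmxr; apply: is_derive_mulmxl.
by move=> /is_derive_mxP/(_ 0 0).
Qed.

End MatrixCalculus.

(** * Symmetry of second derivatives *)

Section Schwarz.
Context {R : realType} {V : normedModType R}.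
Implicit Types (x u v : V) (f : V -> R).

Lemma is_derive_line (W : normedModType R) (f : V -> W) (s : R) (a b : V) d :
  is_derive (s *: a + b) a f d ->
  is_derive (s : R) (1 : R) (fun s : R => f (s *: a + b)) d.
Proof.
have E : (fun h : R => h^-1 *: ((fun s : R => f (s *: a + b)) (h *: (1 : R) + s)
      - f (s *: a + b)))
    = (fun h => h^-1 *: (f (h *: a + (s *: a + b)) - f (s *: a + b))).
  apply/funext => h; congr (_ *: (f _ - _)).
  by rewrite addrA -scalerDl /GRing.scale /= mulr1.
move=> [fa da]; apply: DeriveDef.
  by move: fa; rewrite /derivable /= E.
by move: da; rewrite /derive /= E.
Qed.

(** The mean value theorem applied to [s |-> f (s u + h v + x) - f (s u + x)]
    turns the second difference into [h] times an increment of [g] between two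
    points at distance [O(h)] from [x], which the differentiability of [g] at [x]
    estimates. *)
Lemma second_difference f g x u v :
  (\forall y \near x, is_derive y u f (g y)) -> differentiable g x ->
  forall e, 0 < e -> exists2 d, 0 < d & forall h, 0 < h < d ->
    `|f (h *: u + (h *: v + x)) - f (h *: u + x) - f (h *: v + x) + f x
      - h ^+ 2 * 'D_v g x| <= e * h ^+ 2.
Proof.
move=> fu dg e e0.
pose N := `|u| + `|v| + 1; have N0 : 0 < N by rewrite ltr_wpDl // addr_ge0.
pose e' := e / (2 * N); have e'0 : 0 < e' by rewrite divr_gt0 // mulr_gt0.
have : \forall k \near (0 : V), `|g (k + x) - (g x + 'd g x k)| <= e' * `|k|.
  have [_ H] := (diff_locallyxP x g).1 dg.
  near=> k; rewrite H addrC addKr.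
  near: k; by apply: littleoP.
move=> /nbhs_norm0P[d1 /= d10 Hd1].
have : \forall k \near (0 : V), is_derive (k + x) u f (g (k + x)).
  by move: fu; rewrite (near_shift 0) subr0 /=.
move=> /nbhs_norm0P[d2 /= d20 Hd2].
exists (Num.min d1 d2 / N); first by rewrite divr_gt0 // lt_min d10.
move=> h /andP[h0]; rewrite ltr_pdivlMr // lt_min => /andP[hd1 hd2].
have small s c : 0 <= s <= h -> 0 <= c <= h -> `|s *: u + c *: v| <= h * N.
  move=> /andP[s0 sh] /andP[c0 ch]; apply: (le_trans (ler_normD _ _)).
  rewrite !normrZ !ger0_norm // /N !mulrDr mulr1 -[leLHS]addr0 lerD // ?(ltW h0) //.
  by rewrite lerD // ler_wpM2r.
pose psi s := f (s *: u + (h *: v + x)) - f (s *: u + x).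
pose dpsi s := g (s *: u + (h *: v + x)) - g (s *: u + x).
have hh : 0 <= h <= h by rewrite lexx ltW.
have h00 : (0 : R) <= 0 <= h by rewrite lexx ltW.
have dpsiP s : 0 <= s <= h -> is_derive (s : R) (1 : R) psi (dpsi s).
  move=> sh; apply: is_deriveB; apply: is_derive_line.
    by rewrite addrA; apply: Hd2 => /=; apply: (le_lt_trans (small s h sh hh)).
  apply: Hd2 => /=; apply: (le_lt_trans _ hd2).
  by have := small s 0 sh h00; rewrite scale0r addr0.
have [c ch E] : exists2 c, c \in `[0, h] & psi h - psi 0 = dpsi c * (h - 0).
  apply: MVT_segment (ltW h0) _ _ => [s|].
    by rewrite in_itv /= => /andP[s0 sh]; apply: dpsiP; rewrite !ltW.
  apply: derivable_within_continuous => s; rewrite in_itv /= => sh.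
  by have [] := dpsiP s sh.
have -> : f (h *: u + (h *: v + x)) - f (h *: u + x) - f (h *: v + x) + f x
    = psi h - psi 0.
  by rewrite /psi !scale0r !add0r; ring.
rewrite E subr0 (deriveE v dg).
move: ch; rewrite in_itv /= => ch.
have r1 : `|g (c *: u + (h *: v + x)) - (g x + 'd g x (c *: u + h *: v))|
    <= e' * (h * N).
  rewrite addrA; apply: le_trans (Hd1 _ _) _ => /=.
    exact: le_lt_trans (small c h ch hh) hd1.
  by rewrite ler_wpM2l ?(ltW e'0) // small.
have r2 : `|g (c *: u + x) - (g x + 'd g x (c *: u))| <= e' * (h * N).
  have sm : `|c *: u| <= h * N by have := small c 0 ch h00; rewrite scale0r addr0.
  apply: le_trans (Hd1 _ _) _ => /=; first exact: le_lt_trans sm hd1.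
  by rewrite ler_wpM2l ?(ltW e'0).
have -> : dpsi c * h - h ^+ 2 * 'd g x v = h *
   ((g (c *: u + (h *: v + x)) - (g x + 'd g x (c *: u + h *: v)))
     - (g (c *: u + x) - (g x + 'd g x (c *: u)))).
  have -> : 'd g x (c *: u + h *: v) = 'd g x (c *: u) + h * 'd g x v.
    by rewrite linearD; congr (_ + _); exact: linearZ.
  by rewrite /dpsi; ring.
rewrite normrM gtr0_norm // expr2 mulrCA ler_wpM2l ?(ltW h0) //.
apply: (le_trans (ler_normB _ _)); apply: (le_trans (lerD r1 r2)).
have -> : e' * (h * N) + e' * (h * N) = e * h.
  by rewrite /e'; field; rewrite gt_eqF.
by rewrite mulrC.
Unshelve. all: by end_near. Qed.

(** The second difference is symmetric in [u] and [v].  The derivatives of [f] are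
    given as functions [g] and [h], since the entries of the derivative of a
    matrix-valued function are derivatives of its entries only where it is
    derivable. *)
Lemma derive_comm f g h x u v :
  (\forall y \near x, is_derive y u f (g y)) ->
  (\forall y \near x, is_derive y v f (h y)) ->
  differentiable g x -> differentiable h x -> 'D_v g x = 'D_u h x.
Proof.
move=> fu fv du dv; apply/eqP; rewrite -subr_eq0 -normr_le0.
apply/ler_addgt0Pl => e e0; rewrite addr0.
have e20 : 0 < e / 2 by rewrite divr_gt0.
have [d1 d10 H1] := second_difference v fu du e20.
have [d2 d20 H2] := second_difference u fv dv e20.
pose t := Num.min d1 d2 / 2.
have h0 : 0 < t by rewrite divr_gt0 // lt_min d10.
have hm : t < Num.min d1 d2 by rewrite ltr_pdivrMr // ltr_pMr ?lt_min ?d10 // ltr1n.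
have /H1 : 0 < t < d1 by rewrite h0; move: hm; rewrite lt_min => /andP[].
have /H2 : 0 < t < d2 by rewrite h0; move: hm; rewrite lt_min => /andP[].
clearbody t.
move: ('D_u _ x) ('D_v _ x) => a b; rewrite (addrCA (t *: v) (t *: u) x).
rewrite !ler_norml.
have h2 : 0 < t ^+ 2 by rewrite exprn_gt0.
move=> /andP[A1 A2] /andP[B1 B2].
by apply/andP; split; rewrite -(ler_pM2l h2); lra.
Qed.

End Schwarz.

(** * Curves of symplectic frames *)

(** The join of the norm and of the completeness of matrices, in which
    contractions have fixed points. *)
HB.instance Definition _ (R : realType) (m n : nat) := Complete.on 'M[R]_(m, n).

Section FormNormalization.
Context {R : realType} {m : nat}.
Implicit Types (A B M N W Y : 'M[R]_m).

Lemma mx_norm_entry p q (A : 'M[R]_(p, q)) i j : `|A i j| <= `|A|.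
Proof.
rewrite [leRHS]/Num.Def.normr/= mx_normrE.
exact: (le_bigmax _ (fun ij : 'I_p * 'I_q => `|A ij.1 ij.2|) (i, j)).
Qed.

Lemma mx_norm_mulmx p q r (A : 'M[R]_(p, q)) (B : 'M[R]_(q, r)) :
  `|A *m B| <= q%:R * `|A| * `|B|.
Proof.
rewrite [leLHS]/Num.Def.normr/= mx_normrE; apply: bigmax_le => [|[i k] _ /=].
  by rewrite !mulr_ge0.
rewrite mxE; apply: (le_trans (ler_norm_sum _ _ _)).
rewrite -mulrA mulr_natl -[X in _ *+ X]card_ord -sumr_const.
by apply: ler_sum => l _; rewrite normrM ler_pM // mx_norm_entry.
Qed.

(** Two symplectic forms [N] and [W] close to each other are related by a linear
    map close to [1].  As [N] and [W] are alternating, [1 + E = N^-1 W] is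
    self-adjoint for [N], and so is any square root [1 + Y] of it, whence
    [(1 + Y)^T N (1 + Y) = N (1 + Y)^2 = W].  The square root is a fixed point of
    [phi Y = (E - Y Y) / 2], a contraction of the closed set of the
    [N]-self-adjoint [Y] with [`|Y| <= `|E|]. *)
Lemma form_normalization N W (E := invmx N *m W - 1%:M) :
  N^T = - N -> W^T = - W -> N \in unitmx -> m%:R * `|E| <= 1 / 2 ->
  exists2 Y : 'M[R]_m, `|Y| <= `|E| & (1%:M + Y)^T *m N *m (1%:M + Y) = W.
Proof.
move=> Nt Wt Nu Esmall.
pose sa Y := (N *m Y)^T = - (N *m Y).
pose U : set 'M[R]_m := [set Y | `|Y| <= `|E| /\ sa Y]%classic.
pose phi Y : 'M[R]_m := 2^-1 *: (E - Y *m Y).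
have saE : sa E.
  rewrite /sa /E mulmxBr mulKVmx // mulmx1 linearB /= Wt Nt.
  by rewrite opprB opprK addrC.
have YN Y : sa Y -> Y^T *m N = N *m Y.
  by rewrite /sa trmx_mul Nt mulmxN => /oppr_inj.
have phiU : {homo phi : x / U x >-> U x}%classic.
  move=> Y [YE saY]; split.
    rewrite normrZ ger0_norm ?invr_ge0 // ler_pdivrMl //.
    apply: (le_trans (ler_normB _ _)); rewrite mulr2n mulrDl mul1r lerD //.
    apply: (le_trans (mx_norm_mulmx _ _)).
    apply: (@le_trans _ _ (m%:R * `|E| * `|E|)).
      by rewrite -!mulrA ler_wpM2l // ler_pM.
    by rewrite -[leRHS]mul1r ler_wpM2r //; lra.
  rewrite /sa /phi -scalemxAr linearZ /= mulmxBr linearB /= saE.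
  rewrite mulmxA trmx_mul saY mulmxN mulmxA YN // -mulmxA.
  by rewrite -scalerN opprB opprK addrC mulmxA.
have ctr : is_contraction (mkfun phiU).
  exists (2^-1)%:nng; split; first by rewrite /=; lra.
  move=> [Y Z] [[YE _] [ZE _]] /=.
  have -> : mkfun phiU Y - mkfun phiU Z = 2^-1 *: (Y *m (Z - Y) + (Z - Y) *m Z).
    rewrite /mkfun /phi -scalerBr mulmxBr mulmxBl; congr (_ *: _).
    move: (Y *m Y) (Y *m Z) (Z *m Z) => A B C.
    by apply/matrixP => i k; rewrite !mxE; ring.
  rewrite normrZ ger0_norm ?invr_ge0 // ler_wpM2l ?invr_ge0 //.
  rewrite distrC; apply: (le_trans (ler_normD _ _)).
  have hY : `|Y *m (Z - Y)| <= 1 / 2 * `|Z - Y|.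
    apply: (le_trans (mx_norm_mulmx _ _)); rewrite ler_wpM2r //.
    by apply: le_trans Esmall; rewrite ler_wpM2l.
  have hZ : `|(Z - Y) *m Z| <= 1 / 2 * `|Z - Y|.
    apply: (le_trans (mx_norm_mulmx _ _)); rewrite mulrAC ler_wpM2r //.
    by apply: le_trans Esmall; rewrite ler_wpM2l.
  by apply: (le_trans (lerD hY hZ)); lra.
(* [L] measures the failure to be self-adjoint; its continuity makes [U] closed *)
pose L Y := (N *m Y)^T + N *m Y.
have LB Y Z : L (Y - Z) = L Y - L Z.
  by rewrite /L mulmxBr linearB /= opprD addrACA.
have saL Y : sa Y <-> L Y = 0.
  by rewrite /sa /L; split=> [->|/eqP]; [rewrite addNr|rewrite addr_eq0 => /eqP].
have mx_norm_tr (A : 'M[R]_m) : `|A^T| <= `|A|.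
  rewrite [leLHS]/Num.Def.normr/= mx_normrE; apply: bigmax_le => // -[i k] _ /=.
  by rewrite mxE mx_norm_entry.
have Lb Y : `|L Y| <= 2 * (m%:R * `|N|) * `|Y|.
  apply: (le_trans (ler_normD _ _)); apply: (le_trans (lerD (mx_norm_tr _) (lexx _))).
  by have := mx_norm_mulmx N Y; lra.
have clU : closed U.
  move=> Y clY.
  have near e : 0 < e -> exists2 Z, U Z & `|Y - Z| < e.
    move=> e0; have [] := clY (ball Y e); first exact: nbhsx_ballx.
    by move=> Z [UZ]; rewrite mx_norm_ball => YZ; exists Z.
  split.
    apply/ler_addgt0Pr => e /near[Z [ZE _] YZ].
    rewrite -[Y](subrK Z) addrC; apply: (le_trans (ler_normD _ _)).
    by rewrite lerD // ltW.
  apply/saL/eqP; rewrite -normr_le0; apply/ler_addgt0Pr => e e0; rewrite add0r.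
  pose C := 2 * (m%:R * `|N|) + 1.
  have C0 : 0 < C by rewrite ltr_wpDl // !mulr_ge0.
  have [Z [_ /saL LZ] YZ] := near (e / C) (divr_gt0 e0 C0).
  have -> : L Y = L (Y - Z) by rewrite LB LZ subr0.
  apply: (le_trans (Lb _)); apply: (@le_trans _ _ (C * `|Y - Z|)).
    by rewrite ler_wpM2r // /C lerDl.
  by rewrite -ler_pdivlMl // mulrC ltW.
have [|Y [YE saY] Yfix] := banach_fixed_point ctr clU.
  exists 0; split; first by rewrite normr0.
  by rewrite /sa mulmx0 trmx0 oppr0.
exists Y => //.
have YY : Y + Y + Y *m Y = E.
  have {}Yfix : Y = 2^-1 *: (E - Y *m Y) := Yfix.
  move: (Y *m Y) Yfix => B /matrixP YB; apply/matrixP => i k.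
  by have := YB i k; rewrite !mxE; lra.
have -> : (1%:M + Y)^T = 1%:M + Y^T by rewrite linearD /= trmx1.
rewrite mulmxDl mul1mx YN // -[N in N + _]mulmx1 -mulmxDr.
have -> : N *m (1%:M + Y) *m (1%:M + Y) = N *m (1%:M + E).
  rewrite -YY -mulmxA; congr (_ *m _).
  by rewrite mulmxDl mul1mx mulmxDr mulmx1 !addrA.
by rewrite /E addrC subrK mulKVmx.
Qed.

End FormNormalization.

Section InverseDerivative.
Context {R : realType} {V : normedModType R}.
Implicit Types (x v : V).

Lemma derivable_bigsum (I : Type) (r : seq I) (P : pred I) (f : I -> V -> R) x v :
  (forall i, derivable (f i) x v) ->
  derivable (fun y => \sum_(i <- r | P i) f i y) x v.
Proof.
move=> df; elim: r => [|i r IH].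
  have -> : (fun y => \sum_(i <- [::] | P i) f i y) = cst 0.
    by apply/funext => y; rewrite big_nil.
  exact: derivable_cst.
have -> : (fun y => \sum_(j <- i :: r | P j) f j y)
    = (fun y => (if P i then f i y else 0) + \sum_(j <- r | P j) f j y).
  by apply/funext => y; rewrite big_cons; case: (P i); rewrite ?add0r.
apply: derivableD; last exact: IH.
by case: (P i); [exact: df|exact: derivable_cst].
Qed.

Lemma derivable_bigprod (I : Type) (r : seq I) (P : pred I) (f : I -> V -> R) x v :
  (forall i, derivable (f i) x v) ->
  derivable (fun y => \prod_(i <- r | P i) f i y) x v.
Proof.
move=> df; elim: r => [|i r IH].
  have -> : (fun y => \prod_(i <- [::] | P i) f i y) = cst 1.
    by apply/funext => y; rewrite big_nil.
  exact: derivable_cst.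
have -> : (fun y => \prod_(j <- i :: r | P j) f j y)
    = (fun y => (if P i then f i y else 1) * \prod_(j <- r | P j) f j y).
  by apply/funext => y; rewrite big_cons; case: (P i); rewrite ?mul1r.
apply: derivableM; last exact: IH.
by case: (P i); [exact: df|exact: derivable_cst].
Qed.

Lemma derivable_det m (A : V -> 'M[R]_m) x v :
  (forall i j, derivable (fun y => A y i j) x v) ->
  derivable (fun y => \det (A y)) x v.
Proof.
move=> dA; apply: derivable_bigsum => s; apply: derivableM.
  exact: derivable_cst.
exact: derivable_bigprod.
Qed.

Lemma is_derive_line0 (W : normedModType R) (f : V -> W) x v d :
  is_derive x v f d <->
  is_derive (0 : R) (1 : R) (fun h : R => f (h *: v + x)) d.
Proof.
have E : (fun h : R => h^-1 *: ((fun s : R => f (s *: v + x)) (h *: (1 : R) + 0)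
      - f ((0 : R) *: v + x)))
    = (fun h => h^-1 *: (f (h *: v + x) - f x)).
  by apply/funext => h; rewrite addr0 scale0r add0r /GRing.scale /= mulr1.
split=> - [fa da]; apply: DeriveDef.
- by move: fa; rewrite /derivable /= E.
- by move: da; rewrite /derive /= E.
- by move: fa; rewrite /derivable /= E.
- by move: da; rewrite /derive /= E.
Qed.

End InverseDerivative.

(** Cramer's formula shows that the inverse is derivable; the value then follows
    from the product rule applied to [A t *m invmx (A t) = 1]. *)
Lemma is_derive_invmx0 (R : realType) m (A : R -> 'M[R]_m) dA :
  is_derive (0 : R) (1 : R) A dA -> A 0 \in unitmx ->
  (\forall t \near (0 : R), A t \in unitmx) /\
  is_derive (0 : R) (1 : R) (fun t => invmx (A t))
    (- (invmx (A 0) *m dA *m invmx (A 0))).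
Proof.
move=> dA' Au; have hA := (is_derive_mxP _ _ _ _).1 dA'.
have dentry i j : derivable (fun t => A t i j) (0 : R) (1 : R).
  by have [] := hA i j.
have ddet := derivable_det dentry.
have unear : \forall t \near (0 : R), A t \in unitmx.
  have /derivable1_diffP/differentiable_continuous cdet := ddet.
  have : \forall t \near (0 : R), \det (A t) != 0.
    apply: (cvgr_neq0 (f := fun t => \det (A t)) _ cdet).
    by rewrite -unitfE -unitmxE.
  by apply: filterS => t; rewrite unitmxE unitfE.
have dinv : derivable (fun t => invmx (A t)) (0 : R) (1 : R).
  apply/derivable_mxP => i j.
  suff H : derivable (fun t => (\det (A t))^-1 * cofactor (A t) j i) (0 : R) (1 : R).
    apply: near_eq_derivable H; apply: filterS unear => t ut.
    by rewrite /invmx ut !mxE.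
  apply: derivableM.
    by apply: derivableV ddet; rewrite -unitfE -unitmxE.
  apply: derivableM; first exact: derivable_cst.
  apply: derivable_det => k l.
  have -> : (fun y => row' j (col' i (A y)) k l)
     = (fun y => A y (lift j k) (lift i l)).
    by apply/funext => y; rewrite !mxE.
  exact: dentry.
split=> //.
have [d di] : exists d, is_derive (0 : R) (1 : R) (fun t => invmx (A t)) d.
  by exists ('D_(1 : R) (fun t : R => invmx (A t)) 0); exact: derivableP.
suff <- : d = - (invmx (A 0) *m dA *m invmx (A 0)) by [].
have d1 : is_derive (0 : R) (1 : R) (fun t => A t *m invmx (A t)) 0.
  apply: near_eq_is_derive (is_derive_const 1%:M _ _).
  by apply: filterS unear => t ut; rewrite mulmxV.
have [_ E1] := is_derive_mulmx dA' di; have [_ E2] := d1.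
apply: (can_inj (mulKmx Au)); apply/eqP; rewrite mulmxN -!mulmxA mulKVmx //.
by rewrite -addr_eq0 addrC -E1 E2.
Qed.

Lemma is_derive_invmx (R : realType) (V : normedModType R) m (A : V -> 'M[R]_m)
    x v dA :
  is_derive x v A dA -> A x \in unitmx ->
  is_derive x v (fun y => invmx (A y)) (- (invmx (A x) *m dA *m invmx (A x))).
Proof.
move=> /is_derive_line0 dA' Au.
have x0 : (0 : R) *: v + x = x by rewrite scale0r add0r.
have [|_ d] := is_derive_invmx0 dA'; first by rewrite x0.
by apply/is_derive_line0; rewrite x0 in d.
Qed.

Lemma is_derive_squeeze (R : realType) (U W : normedModType R) (f : R -> U)
    (g : R -> W) :
  (\forall t \near (0 : R), `|g t| <= `|f t|) -> f 0 = 0 ->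
  is_derive (0 : R) (1 : R) f 0 -> is_derive (0 : R) (1 : R) g 0.
Proof.
move=> gf f0 [df ef].
have g0 : g 0 = 0.
  by apply/eqP; rewrite -normr_le0 (le_trans (nbhs_singleton gf)) // f0 normr0.
have gfE : \forall h \near ((0 : R)^')%classic,
    `|h^-1 *: (g (h *: (1 : R) + 0) - g 0)|
    <= `|h^-1 *: (f (h *: (1 : R) + 0) - f 0)|.
  apply: nbhs_dnbhs; apply: filterS gf => h gfh.
  by rewrite f0 g0 !subr0 !normrZ /GRing.scale /= mulr1 addr0 ler_wpM2l.
have cf : (h^-1 *: (f (h *: (1 : R) + 0) - f 0) @[h --> (0 : R)^'] --> (0 : U))%classic.
  by rewrite -ef; exact: df.
have cg : (h^-1 *: (g (h *: (1 : R) + 0) - g 0) @[h --> (0 : R)^'] --> (0 : W))%classic.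
  apply/cvgr0Pnorm_le => e e0.
  move/cvgr0Pnorm_le : cf => /(_ e e0) cf.
  by near=> h; apply: le_trans (near gfE h _) _ => //; near: h.
apply: DeriveDef; first by apply/cvg_ex; exists 0.
by apply: cvg_lim.
Unshelve. all: by end_near. Qed.

(** The equation on [B] is the derivative at 0 of [f^T W f = W 0] when [f 0 = 1] and
    [f' 0 = B].  It says that [Q t = 1 + t B] solves this equation up to [o(t)];
    [form_normalization] corrects [Q t] by a factor [1 + Y t] with [Y t = o(t)],
    which does not change the derivative at 0. *)
Lemma symplectic_frame_curve (R : realType) m (W : R -> 'M[R]_m) dW B :
  (\forall t \near (0 : R), (W t)^T = - W t) -> W 0 \in unitmx ->
  is_derive (0 : R) (1 : R) W dW -> B^T *m W 0 + W 0 *m B + dW = 0 ->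
  exists f : R -> 'M[R]_m, [/\ f 0 = 1%:M, is_derive (0 : R) (1 : R) f B &
    \forall t \near (0 : R), (f t)^T *m W t *m f t = W 0].
Proof.
move=> Wt W0u dW' BW.
pose Q t : 'M[R]_m := t *: B + 1%:M.
have dQ : is_derive (0 : R) (1 : R) Q B.
  exact: (is_derive_line0 id 1%:M B B).1 (is_derive_id _ _).
have Q0 : Q 0 = 1%:M by rewrite /Q scale0r add0r.
pose N t := (Q t)^T *m W t *m Q t.
have N0 : N 0 = W 0 by rewrite /N Q0 trmx1 mul1mx mulmx1.
have dN : is_derive (0 : R) (1 : R) N 0.
  have := is_derive_mulmx (is_derive_mulmx (is_derive_trmx dQ) dW') dQ.
  by rewrite Q0 trmx1 !mul1mx !mulmx1 addrAC BW.
have N0u : N 0 \in unitmx by rewrite N0.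
have [Nu dNi] := is_derive_invmx0 dN N0u.
pose E t := invmx (N t) *m W 0 - 1%:M.
have E0 : E 0 = 0 by rewrite /E N0 mulVmx // subrr.
have dE : is_derive (0 : R) (1 : R) E 0.
  have := is_deriveD (is_derive_mulmxr (W 0) dNi) (is_derive_const (- 1%:M) _ _).
  by rewrite mulmx0 mul0mx oppr0 mul0mx addr0.
have Wt0 := nbhs_singleton Wt.
have Esmall : \forall t \near (0 : R), m%:R * `|E t| <= 1 / 2.
  have [/derivable1_diffP/differentiable_continuous cE _] := dE.
  have e0 : 0 < (1 / 2) / (m%:R + 1) :> R by rewrite !divr_gt0 // ltr_wpDl.
  have {}cE : (E t @[t --> (0 : R)] --> (0 : 'M[R]_m))%classic.
    by rewrite -[X in (_ --> X)%classic]E0; exact: cE.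
  move/cvgr0Pnorm_le : cE => /(_ _ e0); apply: filterS => t Et.
  apply: (@le_trans _ _ ((m%:R + 1) * `|E t|)); first by rewrite ler_wpM2r // lerDl.
  by rewrite mulrC -ler_pdivlMr // ltr_wpDl.
(* [Y] is chosen point by point; the bound by [E], which is [o(t)], makes it derivable
   at 0 *)
pose S t := [set Y : 'M[R]_m | `|Y| <= `|E t| /\
   (1%:M + Y)^T *m N t *m (1%:M + Y) = W 0]%classic.
pose Y t := xget 0 (S t).
have YP : \forall t \near (0 : R), `|Y t| <= `|E t| /\
   (1%:M + Y t)^T *m N t *m (1%:M + Y t) = W 0.
  near=> t.
  have Nt : (N t)^T = - N t.
    by rewrite /N !trmx_mul trmxK (near Wt t) // mulNmx mulmxN mulmxA.
  have [||Z Z1 Z2] := form_normalization Nt Wt0.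
  - by near: t.
  - by near: t.
  - have : S t (Y t) by apply: xgetPex; exists Z.
    exact.
exists (fun t => Q t *m (1%:M + Y t)).
have Y0 : Y 0 = 0.
  have [+ _] := nbhs_singleton YP; rewrite E0 normr0 normr_le0 => /eqP; exact.
split.
- by rewrite Q0 Y0 addr0 mulmx1.
- have dY : is_derive (0 : R) (1 : R) Y 0.
    by apply: is_derive_squeeze dE => //; apply: filterS YP => t [].
  have d1Y : is_derive (0 : R) (1 : R) (fun t => 1%:M + Y t) 0.
    by have := is_deriveD (is_derive_const 1%:M _ _) dY; rewrite addr0.
  by have := is_derive_mulmx dQ d1Y; rewrite /= Y0 addr0 mulmx0 mulmx1 addr0.
- by apply: filterS YP => t [_ <-]; rewrite trmx_mul /N !mulmxA.
Unshelve. all: by end_near. Qed.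

(** * Curvature in a chart *)

Section SmoothOn.
Context {R : realType} {m : nat} {V : normedModType R}.
Implicit Types (U : set 'cV[R]_m) (f : 'cV[R]_m -> V) (x u v : 'cV[R]_m).

Lemma smooth_on_cst U (a : V) : smooth_on U (cst a : 'cV[R]_m -> V).
Proof.
move=> k; elim: k a => [|k IH] a /=; first by move=> x _; exact: cst_continuous.
split=> [x _|v]; first exact: differentiable_cst.
have -> : (fun x => 'D_v (cst a) x) = cst (0 : V).
  by apply/funext => x; rewrite derive_cst.
exact: IH.
Qed.

Lemma smooth_on_differentiable U f x : smooth_on U f -> U x -> differentiable f x.
Proof. by move=> /(_ 1)[+ _]; apply. Qed.

Lemma smooth_on_derive_differentiable U f x v :
  smooth_on U f -> U x -> differentiable (fun y => 'D_v f y) x.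
Proof. by move=> /(_ 2)[_ /(_ v)[+ _]]; apply. Qed.

Lemma smooth_on_is_derive U f x v :
  smooth_on U f -> U x -> is_derive x v f ('D_v f x).
Proof.
by move=> sf Ux; apply/derivableP/diff_derivable/(smooth_on_differentiable sf Ux).
Qed.

Lemma derive_linear f x a u v : differentiable f x ->
  'D_(a *: u + v) f x = a *: 'D_u f x + 'D_v f x.
Proof. by move=> df; rewrite !deriveE // linearP. Qed.

End SmoothOn.

Section ChartCurvature.
Context {R : realType} {m : nat} {M : manifold R m}.
Variables (w : symplectic_form M) (nabla : connection M).
Variables (c : chart R m M) (hc : atlas c).
Local Notation G := (christoffel nabla c).
Local Notation W := (sform w c).
Implicit Types (x u v z : 'cV[R]_m).

Lemma cimg_open : open (cimg c).
Proof. by have [] := atlas_chart hc. Qed.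

Lemma cimg_near x : cimg c x -> \forall y \near x, cimg c y.
Proof. by move=> cx; apply: open_nbhs_nbhs; split=> //; exact: cimg_open. Qed.

Lemma sform_tr x : cimg c x -> (W x)^T = - W x.
Proof. by move=> cx; apply: form_alt_tr; apply: sform_alt. Qed.

Lemma sform_unit x : cimg c x -> W x \in unitmx.
Proof. by move=> cx; apply: form_nondeg_unit; exact: sform_nondeg. Qed.

Definition dsform x u : 'M[R]_m := 'D_u W x.

Lemma sform_is_derive x u : cimg c x -> is_derive x u W (dsform x u).
Proof. by move=> cx; apply: smooth_on_is_derive cx; exact: sform_smooth. Qed.

(** Derivatives of the Christoffel matrices, under a name which keeps them from
    being unfolded when matrix identities are rewritten. *)
Definition dchristoffel x u v : 'M[R]_m := 'D_u (fun y => G y v) x.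

Lemma christoffel_is_derive x u v : cimg c x ->
  is_derive x u (fun y => G y v) (dchristoffel x u v).
Proof. by move=> cx; apply: smooth_on_is_derive cx; exact: christoffel_smooth. Qed.

Lemma christoffel0 x : cimg c x -> G x 0 = 0.
Proof.
move=> cx; have := christoffel_linear nabla hc cx 1 0 0.
rewrite scaler0 addr0 scale1r => /eqP.
by rewrite -subr_eq0 opprD addNKr oppr_eq0 => /eqP.
Qed.

Definition curvature_tensor x u v : 'M[R]_m :=
  dchristoffel x u v - dchristoffel x v u
  + G x u *m G x v - G x v *m G x u.

Lemma cov_cst u v x : cov G (cst u) (cst v) x = G x u *m v.
Proof. by rewrite /cov /= derive_cst add0r. Qed.

Lemma curvatureE x u v z : cimg c x ->
  curvature nabla c x u v z = curvature_tensor x u v *m z.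
Proof.
move=> cx; rewrite /curvature /curvature_field.
have E a : cov G (cst a) (cst z) = (fun y => G y a *m z).
  by apply/funext => y; exact: cov_cst.
have -> : bracket (cst u) (cst v) = cst 0 :> ('cV[R]_m -> 'cV[R]_m).
  by apply/funext => y; rewrite /bracket !derive_cst subr0.
rewrite cov_cst christoffel0 // mul0mx subr0 !E /cov /=.
have D a b : 'D_a (fun y => G y b *m z) x = dchristoffel x a b *m z.
  by have [_] := is_derive_mulmxr z (christoffel_is_derive a b cx).
rewrite !D /curvature_tensor !mulmxDl !mulNmx !mulmxA.
by rewrite opprD addrACA addrA.
Qed.

Lemma curvature_mxE x u v : cimg c x ->
  curvature_mx nabla c x u v = curvature_tensor x u v.
Proof.
move=> cx; apply: mulmx_ext => z; rewrite /curvature_mx endo_mxE ?curvatureE //.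
by move=> a z1 z2; rewrite !curvatureE // mulmxDr -scalemxAr.
Qed.

Lemma curvature_tensor_alt x u v :
  curvature_tensor x u v = - curvature_tensor x v u.
Proof.
rewrite /curvature_tensor.
move: (dchristoffel x u v) (dchristoffel x v u) (_ *m _) (_ *m _) => A B C D.
by apply/matrixP => i k; rewrite !mxE; ring.
Qed.

Lemma curvature_tensor_linear x a u u' v : cimg c x ->
  curvature_tensor x (a *: u + u') v
  = a *: curvature_tensor x u v + curvature_tensor x u' v.
Proof.
move=> cx; rewrite /curvature_tensor.
have -> : dchristoffel x (a *: u + u') v
    = a *: dchristoffel x u v + dchristoffel x u' v.
  apply: derive_linear.
  by apply: smooth_on_differentiable cx; exact: christoffel_smooth.
have -> : dchristoffel x v (a *: u + u')
    = a *: dchristoffel x v u + dchristoffel x v u'.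
  transitivity ('D_v (a \*: (fun y => G y u) + (fun y => G y u')) x).
    apply: near_eq_derive; near=> y; apply: christoffel_linear => //.
    by near: y; exact: cimg_near.
  have [d1 _] := christoffel_is_derive v u cx.
  have [d2 _] := christoffel_is_derive v u' cx.
  by rewrite (deriveD (derivableZ (k := a) d1) d2) (deriveZ _ d1).
rewrite christoffel_linear // mulmxDl mulmxDr -scalemxAl -scalemxAr.
move: (_ *m _) (_ *m _) (_ *m _) (_ *m _) => A B C D.
move: (dchristoffel x u v) (dchristoffel x u' v) => A1 B1.
move: (dchristoffel x v u) (dchristoffel x v u') => C1 D1.
by apply/matrixP => i k; rewrite !mxE; ring.
Unshelve. all: by end_near. Qed.

Hypothesis torsion : torsion_free nabla.
Hypothesis preserves : preserves_form w nabla.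

Lemma christoffel_sym x u v : cimg c x -> G x u *m v = G x v *m u.
Proof.
move=> cx; have := torsion hc (smooth_on_cst _ u) (smooth_on_cst _ v) cx.
rewrite !cov_cst /bracket !derive_cst !subr0 => /eqP.
by rewrite subr_eq0 => /eqP.
Qed.

Lemma sform_derive x u : cimg c x ->
  dsform x u = (G x u)^T *m W x + W x *m G x u.
Proof.
move=> cx; apply: form_inj => a b.
have := preserves hc (smooth_on_cst _ u) (smooth_on_cst _ a) (smooth_on_cst _ b) cx.
rewrite !cov_cst /= formDmx -form_mull -form_mulr => <-.
by have [_ ->] := is_derive_form a b (sform_is_derive u cx).
Qed.

(** By symmetry of the Christoffel symbols [dG u v z] and [G_u G_v z] are symmetric
    in [v] and [z], so that the cyclic sum cancels in pairs. *)
Lemma curvature_tensor_Bianchi x u v z : cimg c x ->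
  curvature_tensor x u v *m z + curvature_tensor x v z *m u
  + curvature_tensor x z u *m v = 0.
Proof.
move=> cx.
have E a b d : dchristoffel x a b *m d = dchristoffel x a d *m b.
  have [_ <-] := is_derive_mulmxr d (christoffel_is_derive a b cx).
  have [_ <-] := is_derive_mulmxr b (christoffel_is_derive a d cx).
  apply: near_eq_derive; near=> y; apply: christoffel_sym.
  by near: y; exact: cimg_near.
have S a b d : G x a *m G x b *m d = G x a *m G x d *m b.
  by rewrite -!mulmxA (christoffel_sym b d cx).
rewrite /curvature_tensor; move: (dchristoffel x) (G x) E S => dG g E S.
rewrite !mulmxDl !mulNmx (E u v z) (E v z u) (E z u v).
rewrite (S u v z) (S v z u) (S z u v).
move: (_ *m z) (_ *m z) (_ *m u) (_ *m u) (_ *m v) (_ *m v) => A B C D F H.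
by apply/matrixP => i k; rewrite !mxE; ring.
Unshelve. all: by end_near. Qed.

(** Differentiating [D_v W = G_v^T W + W G_v] along [u] and antisymmetrizing, the
    second derivatives of [W] cancel and [K^T W + W K = 0] remains. *)
Lemma curvature_tensor_sp x u v a b : cimg c x ->
  form (W x) (curvature_tensor x u v *m a) b
  = - form (W x) a (curvature_tensor x u v *m b).
Proof.
move=> cx.
pose ddW a1 b1 : 'M[R]_m := 'D_a1 (fun y => 'D_b1 W y) x.
have dd a1 b1 : is_derive x a1 (fun y => 'D_b1 W y) (ddW a1 b1).
  apply/derivableP/diff_derivable.
  by apply: smooth_on_derive_differentiable cx; exact: sform_smooth.
have Wd a1 b1 : ddW a1 b1
   = (dchristoffel x a1 b1)^T *m W x + (G x b1)^T *m dsform x a1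
     + (dsform x a1 *m G x b1 + W x *m dchristoffel x a1 b1).
  transitivity ('D_a1 (fun y => (G y b1)^T *m W y + W y *m G y b1) x).
    apply: near_eq_derive; near=> y; apply: sform_derive.
    by near: y; exact: cimg_near.
  have dG := christoffel_is_derive a1 b1 cx; have dW := sform_is_derive a1 cx.
  by have [_ ->] := is_deriveD (is_derive_mulmx (is_derive_trmx dG) dW)
    (is_derive_mulmx dW dG).
have comm : ddW u v = ddW v u.
  apply/matrixP => i k.
  have dentry b1 : \forall y \near x,
      is_derive y b1 (fun y => W y i k) (('D_b1 W y) i k).
    near=> y; have cy : cimg c y by near: y; exact: cimg_near.
    exact: ((is_derive_mxP _ _ _ _).1 (sform_is_derive b1 cy) i k).
  have diffe b1 : differentiable (fun y => ('D_b1 W y) i k) x.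
    apply: (@differentiable_comp _ _ _ _ (fun y => 'D_b1 W y) (fun A => A i k)).
      by apply: smooth_on_derive_differentiable cx; exact: sform_smooth.
    exact: differentiable_coord.
  have [_ e1] := (is_derive_mxP _ _ _ _).1 (dd u v) i k.
  have [_ e2] := (is_derive_mxP _ _ _ _).1 (dd v u) i k.
  apply: etrans (esym e1) _; apply: etrans _ e2.
  exact: esym (derive_comm (dentry u) (dentry v) (diffe u) (diffe v)).
suff : (curvature_tensor x u v)^T *m W x + W x *m curvature_tensor x u v = 0.
  move=> E; apply/eqP; rewrite -addr_eq0 form_mull form_mulr -formDmx E.
  by rewrite form0mx.
clearbody ddW; move: comm; rewrite (Wd u v) (Wd v u).
rewrite (sform_derive u cx) (sform_derive v cx) /curvature_tensor.
move: (dchristoffel x) (G x) (W x) => dG g W0 E; clear -E.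
move/eqP: E; rewrite -subr_eq0 => /eqP <-.
have trD (A B : 'M[R]_m) : (A + B)^T = A^T + B^T by rewrite linearD.
have trN (A : 'M[R]_m) : (- A)^T = - A^T by rewrite linearN.
rewrite !(trD, trN) !trmx_mul !(mulmxDl, mulmxDr, mulNmx, mulmxN).
rewrite !mulmxA.
move: ((dG u v)^T *m _) ((dG v u)^T *m _) => A B.
move: (_ *m dG u v) (_ *m dG v u) => C D.
move: (_ *m _ *m _) (_ *m _ *m _) (_ *m _ *m _) (_ *m _ *m _) => A1 B1 C1 D1.
by apply/matrixP => i k; rewrite !mxE; ring.
Unshelve. all: by end_near. Qed.

Lemma curvature_tensor_curvature x : cimg c x ->
  symplectic_curvature (W x) (curvature_tensor x).
Proof.
move=> cx; split=> [a u u' v|u v|u v a b|u v z].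
- exact: curvature_tensor_linear.
- exact: curvature_tensor_alt.
- exact: curvature_tensor_sp.
- exact: curvature_tensor_Bianchi.
Qed.

End ChartCurvature.

(** * Tangent spaces of the twistor space *)

Section PairDerivative.
Context {R : realType} {V U W : normedModType R}.
Implicit Types (x v : V).

Lemma is_derive_pair (f : V -> U) (g : V -> W) x v df dg :
  is_derive x v f df -> is_derive x v g dg ->
  is_derive x v (fun y => (f y, g y)) (df, dg).
Proof.
move=> [cf ef] [cg eg].
have c : (h^-1 *: ((f (h *: v + x), g (h *: v + x)) - (f x, g x)) @[h --> (0 : R)^']
    --> (df, dg))%classic.
  have cf' : (h^-1 *: (f (h *: v + x) - f x) @[h --> (0 : R)^'] --> df)%classic.
    by rewrite -ef; exact: cf.
  have cg' : (h^-1 *: (g (h *: v + x) - g x) @[h --> (0 : R)^'] --> dg)%classic.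
    by rewrite -eg; exact: cg.
  exact: cvg_pair cf' cg'.
by apply: DeriveDef; [apply/cvg_ex; exists (df, dg)|apply: cvg_lim].
Qed.

Lemma is_derive_fst (f : V -> U * W) x v df :
  is_derive x v f df -> is_derive x v (fun y => (f y).1) df.1.
Proof.
move=> [cf ef].
have cf' : (h^-1 *: (f (h *: v + x) - f x) @[h --> (0 : R)^'] --> df)%classic.
  by rewrite -ef; exact: cf.
have c : (h^-1 *: ((f (h *: v + x)).1 - (f x).1) @[h --> (0 : R)^'] --> df.1)%classic.
  have c0 : (p.1 @[p --> df] --> df.1)%classic by exact: cvg_fst.
  exact: cvg_trans (cvg_comp _ _ cf' c0).
by apply: DeriveDef; [apply/cvg_ex; exists df.1|apply: cvg_lim].
Qed.

Lemma is_derive_snd (f : V -> U * W) x v df :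
  is_derive x v f df -> is_derive x v (fun y => (f y).2) df.2.
Proof.
move=> [cf ef].
have cf' : (h^-1 *: (f (h *: v + x) - f x) @[h --> (0 : R)^'] --> df)%classic.
  by rewrite -ef; exact: cf.
have c : (h^-1 *: ((f (h *: v + x)).2 - (f x).2) @[h --> (0 : R)^'] --> df.2)%classic.
  have c0 : (p.2 @[p --> df] --> df.2)%classic by exact: cvg_snd.
  exact: cvg_trans (cvg_comp _ _ cf' c0).
by apply: DeriveDef; [apply/cvg_ex; exists df.2|apply: cvg_lim].
Qed.

Lemma is_derive_comp_curve (f : R -> U) (g : U -> W) (t : R) df :
  is_derive t (1 : R) f df -> differentiable g (f t) ->
  is_derive t (1 : R) (g \o f) ('D_df g (f t)).
Proof.
move=> [df1 <-] dg; have df2 := (derivable1_diffP f t).1 df1.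
have dgf : differentiable (g \o f) t by apply: differentiable_comp.
apply: DeriveDef; first exact: diff_derivable.
by rewrite !deriveE // diff_comp.
Qed.

End PairDerivative.

Section TwistorGeometry.
Context {R : realType} {n : nat} {M : manifold R (n + n)}.
Variables (w : symplectic_form M) (nabla : connection M).
Variables (c : chart R (n + n) M) (hc : atlas c).
Hypothesis torsion : torsion_free nabla.
Hypothesis preserves : preserves_form w nabla.
Local Notation G := (christoffel nabla c).
Local Notation W := (sform w c).
Local Notation E := ('cV[R]_(n + n) * 'M[R]_(n + n))%type.
Implicit Types (x X Y : 'cV[R]_(n + n)) (j S : 'M[R]_(n + n)) (z Xi : E).

(** The component along the fibre of the horizontal lift of [X]. *)
Definition horizontal_part x j X : 'M[R]_(n + n) := j *m G x X - G x X *m j.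

(** The linearized equations of the twistor fibre. *)
Definition vertical_at x j S :=
  S *m j + j *m S = 0 /\ S^T *m W x + W x *m S = 0.

Lemma derive_pi1 (xi eta : E) : xi.2 \in unitmx ->
  'D_eta (@pi1 R n) xi = (eta.1,
    eta.2 *m j0 *m invmx xi.2
    - xi.2 *m j0 *m invmx xi.2 *m eta.2 *m invmx xi.2).
Proof.
move=> u.
have d1 : is_derive xi eta (fun y : E => y.1) eta.1.
  exact: is_derive_fst (is_derive_id _ _).
have d2 : is_derive xi eta (fun y : E => y.2) eta.2.
  exact: is_derive_snd (is_derive_id _ _).
have d3 := is_derive_mulmx (is_derive_mulmxr j0 d2) (is_derive_invmx d2 u).
have [_ ->] := is_derive_pair d1 d3.
by rewrite mulmxN !mulmxA.
Qed.

(** Every [j] has a unitary frame [a], and the horizontal velocity [- G_X a] of this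
    frame moves [a j0 a^-1] with velocity [j G_X - G_X j], independently of [a]. *)
Lemma horizontalP x j Xi : twistor w c (x, j) ->
  horizontal w nabla c (x, j) Xi <-> Xi.2 = horizontal_part x j Xi.1.
Proof.
move=> [/= cx cj]; split.
- move=> [[y a] [[/= cy [au aW]] [yx aj] [eta h <-]]].
  rewrite derive_pi1 //= /horizontal_part -aj -yx.
  have -> : eta.2 = - (G y eta.1 *m a) by apply/eqP; rewrite -addr_eq0; apply/eqP.
  rewrite !mulNmx mulmxN !mulNmx opprK addrC !mulmxA.
  by congr (_ - _); rewrite -!mulmxA mulmxV // mulmx1.
- have [a aW aj] := exists_unitary_frame (sform_tr w hc cx) cj.
  have au := frame_unit aW.
  have ajE : a *m j0 *m invmx a = j by rewrite aj mulmxK.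
  case: Xi => X S /= SE; exists (x, a); split => /=.
  + by split=> //=; split=> // Y Z; rewrite form_mull form_mulr aW.
  + by rewrite /pi1 /= ajE.
  exists (X, - (G x X *m a)); first by rewrite /frame_horizontal /= addNr.
  rewrite derive_pi1 //= SE ajE /horizontal_part; congr (_, _).
  rewrite mulmxN !mulNmx opprK addrC -!mulmxA mulmxV // mulmx1.
  by rewrite (mulmxA a) ajE.
Qed.

Lemma vertical_compat x j : compatible (W x) j -> forall S,
  S *m j + j *m S = 0 -> S^T *m W x *m j + j^T *m W x *m S = 0 ->
  vertical_at x j S.
Proof.
move=> cj S Sj h; split=> //; have [jj _ _] := cj.
have jS : j *m S = - (S *m j) by apply/eqP; rewrite -addr_eq0 addrC Sj.
have : (S^T *m W x + W x *m S) *m j = 0.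
  rewrite mulmxDl -h; congr (_ + _).
  by rewrite (compatible_trl cj) mulNmx -!mulmxA jS mulmxN opprK.
move=> /(congr1 (mulmx^~ j)); rewrite mul0mx -mulmxA jj mulmxN mulmx1 => /eqP.
by rewrite oppr_eq0 => /eqP.
Qed.

(** Differentiating the two equations of the twistor space along a curve gives
    linear equations on its velocity [(X, S)], in which [W] varies by
    [G_X^T W + W G_X]; subtracting the horizontal part of [X] absorbs this term. *)
Lemma tangent_vertical x j Xi : twistor w c (x, j) ->
  twistor_tangent w c (x, j) Xi ->
  vertical_at x j (Xi.2 - horizontal_part x j Xi.1).
Proof.
move=> [/= cx cj] [gamma [g0 gnear dg]].
have [jj jW _] := cj.
have d1 := is_derive_fst dg; have d2 := is_derive_snd dg.
set X := Xi.1 in d1 *; set S := Xi.2 in d2 *.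
have g02 : (gamma 0).2 = j by rewrite g0.
have Sj : S *m j + j *m S = 0.
  have e : is_derive (0 : R^o) (1 : R^o) (fun t => (gamma t).2 *m (gamma t).2) 0.
    apply: near_eq_is_derive (is_derive_const (- 1%:M) _ _).
    by apply: filterS gnear => t [_ [-> _ _]].
  have [_ <-] := e; have [_ ->] := is_derive_mulmx d2 d2.
  by rewrite g02.
have dWg : is_derive (0 : R^o) (1 : R^o) (fun t => W (gamma t).1) (dsform w c x X).
  have g01 : (gamma 0).1 = x by rewrite g0.
  have : differentiable W (gamma 0).1.
    by rewrite g01; apply: smooth_on_differentiable cx; exact: sform_smooth.
  by move=> /(is_derive_comp_curve d1); rewrite g01.
have SW : (S^T *m W x + j^T *m dsform w c x X) *m j + j^T *m W x *m S
    = dsform w c x X.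
  have e : is_derive (0 : R^o) (1 : R^o)
      (fun t => (gamma t).2^T *m W (gamma t).1 *m (gamma t).2) (dsform w c x X).
    apply: near_eq_is_derive dWg.
    apply: filterS gnear => t [_ [_ gW _]].
    by apply: form_inj => a b; rewrite -gW form_mull form_mulr.
  have [_ e1] := e; apply: etrans _ e1.
  have [_ ->] := is_derive_mulmx (is_derive_mulmx (is_derive_trmx d2) dWg) d2.
  by rewrite g0.
have jtWj := compatible_trK cj.
rewrite (sform_derive hc preserves X cx) in SW.
apply: vertical_compat => //; rewrite /horizontal_part.
  transitivity (S *m j + j *m S); last exact: Sj.
  rewrite !(mulmxDl, mulmxDr, mulNmx, mulmxN) !mulmxA jj -!mulmxA jj.
  rewrite !(mulNmx, mulmxN) mul1mx mulmx1.
  by apply/matrixP => i k; rewrite !mxE; ring.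
have trD (A B : 'M[R]_(n + n)) : (A + B)^T = A^T + B^T by rewrite linearD.
have trN (A : 'M[R]_(n + n)) : (- A)^T = - A^T by rewrite linearN.
move: (G x X) SW => g SW.
rewrite !(trD, trN) !trmx_mul !(mulmxDl, mulmxDr, mulNmx, mulmxN).
rewrite !(mulmxDl, mulmxDr) !mulmxA in SW *.
have gj : g^T *m j^T *m W x *m j = g^T *m W x by rewrite -[in RHS]jtWj !mulmxA.
rewrite jtWj gj; move: (W x) SW => W0 SW; clear -SW.
by apply/matrixP => i k; move/matrixP/(_ i k): SW; rewrite !mxE; lra.
Qed.

(** The curve is the conjugate [f t *m j *m (f t)^-1] by symplectic frames over the
    straight line [x + t X], which is compatible with the form at each point.
    With [A = - (S j) / 2], which is in the symplectic Lie algebra and satisfies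
    [A j - j A = S], the initial velocity [A - G_X] of [f] gives the required
    one. *)
Lemma twistor_tangentI x j X S : twistor w c (x, j) -> vertical_at x j S ->
  twistor_tangent w c (x, j) (X, S + horizontal_part x j X).
Proof.
move=> [/= cx cj] [Sj SW]; have [jj jW _] := cj.
have jtW := compatible_trl cj.
have jS : j *m S = - (S *m j) by apply/eqP; rewrite -addr_eq0 addrC Sj.
pose A := - (2^-1 *: (S *m j)).
have Aj : A *m j - j *m A = S.
  rewrite /A mulNmx mulmxN opprK -scalemxAl -scalemxAr mulmxA jS mulNmx -!mulmxA.
  rewrite jj !mulmxN mulmx1 opprK scalerN opprK -scalerDl -[RHS]scale1r.
  by congr (_ *: _); lra.
have AW : A^T *m W x + W x *m A = 0.
  have StW : S^T *m W x = - (W x *m S) by apply/eqP; rewrite -addr_eq0 SW.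
  rewrite /A linearN linearZ /= mulNmx mulmxN -scalemxAl -scalemxAr trmx_mul.
  rewrite -(mulmxA j^T) StW mulmxN mulmxA jtW mulNmx opprK -mulmxA jS mulmxN.
  by rewrite scalerN opprK mulmxA subrr.
pose B := A - G x X.
pose y (t : R^o) : 'cV[R]_(n + n) := t *: X + x.
have y0 : y 0 = x by rewrite /y scale0r add0r.
have dy : is_derive (0 : R^o) (1 : R^o) y X.
  exact: (is_derive_line0 id x X X).1 (is_derive_id _ _).
have dWy : is_derive (0 : R^o) (1 : R^o) (W \o y) (dsform w c x X).
  have : differentiable W (y 0).
    by rewrite y0; apply: smooth_on_differentiable cx; exact: sform_smooth.
  by move=> /(is_derive_comp_curve dy); rewrite y0.
have cy : \forall t \near (0 : R^o), cimg c (y t).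
  have [/derivable1_diffP/differentiable_continuous cy _] := dy.
  apply: cy; rewrite y0; exact: cimg_near.
have Wt : \forall t \near (0 : R^o), (W (y t))^T = - W (y t).
  by apply: filterS cy => t; exact: sform_tr.
have [||f [f0 df fW]] := symplectic_frame_curve (B := B) Wt _ dWy.
- by rewrite y0; exact: sform_unit.
- rewrite y0 (sform_derive hc preserves _ cx) /B linearB /= mulmxBl mulmxBr.
  by rewrite (addrACA (A^T *m W x)) AW add0r -opprD addNr.
have fu0 : f 0 \in unitmx by rewrite f0 unitmx1.
have [fu dfi] := is_derive_invmx0 df fu0.
exists (fun t => (y t, f t *m j *m invmx (f t))); split.
- by rewrite y0 f0 invmx1 mulmx1 mul1mx.
- near=> t; split; first by near: t.
  apply: compatible_conj cj _ _ => /=.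
    by rewrite mulmxV //; near: t.
  move=> a b; rewrite form_mull form_mulr; congr (form _ a b).
  by rewrite -[in RHS]y0; near: t.
- have := is_derive_pair dy (is_derive_mulmx (is_derive_mulmxr j df) dfi).
  rewrite f0 invmx1 !mulmx1 !mul1mx /= mulmxN.
  suff -> : B *m j + - (j *m B) = S + horizontal_part x j X by [].
  rewrite /B /horizontal_part mulmxBl mulmxBr -Aj.
  by rewrite opprB addrACA (addrC (- _)) addrACA.
Unshelve. all: by end_near. Qed.

Lemma horizontalE x j X : twistor w c (x, j) ->
  horizontal w nabla c (x, j) (X, horizontal_part x j X).
Proof. by move=> tz; apply/horizontalP. Qed.

Lemma verticalP x j S : twistor w c (x, j) ->
  vertical w c (x, j) (0, S) <-> vertical_at x j S.
Proof.
move=> tz; have [/= cx _] := tz.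
have h0 : horizontal_part x j 0 = 0.
  by rewrite /horizontal_part christoffel0 // mul0mx mulmx0 subr0.
split=> [[t _]|v].
  by have := tangent_vertical tz t; rewrite /= h0 subr0.
by split=> //; have := twistor_tangentI 0 tz v; rewrite h0 addr0.
Qed.

Lemma PVE x j S X : twistor w c (x, j) -> vertical_at x j S ->
  PV w nabla c (x, j) (X, S + horizontal_part x j X) = (0, S).
Proof.
move=> tz v; apply: xget_unique.
  split; first exact/verticalP.
  by apply/horizontalP => //=; rewrite subr0 addrC addKr.
move=> [Y T] [[_ /= ->]] /horizontalP -/(_ tz) /=; rewrite subr0 => e.
by move/eqP: e; rewrite subr_eq (addrC S) => /eqP/addrI ->.
Qed.

Lemma horizontal_liftE x j X : twistor w c (x, j) ->
  horizontal_lift w nabla c (x, j) X = (X, horizontal_part x j X).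
Proof.
move=> tz; apply: xget_unique; first by split=> //; exact: horizontalE.
by move=> [Y T] [/horizontalP -/(_ tz) /= -> ->].
Qed.

Lemma tangentP x j Xi : twistor w c (x, j) -> twistor_tangent w c (x, j) Xi ->
  exists2 S, vertical_at x j S & Xi = (Xi.1, S + horizontal_part x j Xi.1).
Proof.
move=> tz t; exists (Xi.2 - horizontal_part x j Xi.1).
  exact: tangent_vertical tz t.
by rewrite subrK; case: Xi {t}.
Qed.

Lemma vertical_mulj x j S : twistor w c (x, j) -> vertical_at x j S ->
  vertical_at x j (j *m S).
Proof.
move=> [/= cx cj] [Sj SW]; have [jj _ _] := cj.
have jS : j *m S = - (S *m j) by apply/eqP; rewrite -addr_eq0 addrC Sj.
have StW : S^T *m W x = - (W x *m S) by apply/eqP; rewrite -addr_eq0 SW.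
split.
  by rewrite -mulmxA -mulmxDr Sj mulmx0.
rewrite trmx_mul -mulmxA (compatible_trl cj) mulmxN (mulmxA S^T) StW mulNmx opprK.
by rewrite -!mulmxA -mulmxDr addrC jS addNr mulmx0.
Qed.

Lemma JnablaE eps x j S X : twistor w c (x, j) -> vertical_at x j S ->
  Jnabla w nabla eps c (x, j) (X, S + horizontal_part x j X)
  = (eps *: (j *m X), j *m S + horizontal_part x j (eps *: (j *m X))).
Proof.
move=> tz v; rewrite /Jnabla PVE // horizontal_liftE //=.
by congr (_, _); [rewrite addr0|rewrite addrC].
Qed.

(** The imaginary parts of both sides agree, being built from the same matrix:
    [(j S)(j S') = S S'].  The real parts are compared by bilinearity of the
    curvature and [eps ^ 2 = 1]. *)
Lemma twistor_form_Jnabla eps x j Xi Xi' : eps ^+ 2 = 1 ->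
  twistor w c (x, j) ->
  twistor_tangent w c (x, j) Xi -> twistor_tangent w c (x, j) Xi' ->
  twistor_form w nabla c (x, j) (Jnabla w nabla eps c (x, j) Xi)
                               (Jnabla w nabla eps c (x, j) Xi')
  = twistor_form w nabla c (x, j) Xi Xi' <->
  \tr (curvature_mx nabla c x (j *m Xi.1) (j *m Xi'.1) *m j)
  = \tr (curvature_mx nabla c x Xi.1 Xi'.1 *m j).
Proof.
move=> eps2 tz /(tangentP tz)[S v ->] /(tangentP tz)[S' v' ->].
have [/= cx [jj _ _]] := tz; move: Xi.1 Xi'.1 => X X'.
have w1 := vertical_mulj tz v; have w1' := vertical_mulj tz v'.
rewrite (JnablaE eps X tz v) (JnablaE eps X' tz v') /twistor_form.
rewrite (PVE X tz v) (PVE X' tz v') (PVE _ tz w1) (PVE _ tz w1').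
have jSS T T' : vertical_at x j T -> vertical_at x j T' ->
    j *m T *m (j *m T') = T *m T'.
  move=> [Tj _] _.
  have Tj' : j *m T = - (T *m j) by apply/eqP; rewrite -addr_eq0 addrC Tj.
  by rewrite Tj' mulNmx -mulmxA (mulmxA j j) jj mulNmx mul1mx mulmxN opprK.
rewrite /= (jSS _ _ v v') (jSS _ _ v' v) !(curvature_mxE _ hc) //.
have -> : curvature_tensor nabla c x (eps *: (j *m X)) (eps *: (j *m X'))
    = curvature_tensor nabla c x (j *m X) (j *m X').
  have Kc := curvature_tensor_curvature hc torsion preserves cx.
  by rewrite (curvZl Kc) (curvZr Kc) scalerA -expr2 eps2 scale1r.
split=> [/addIr|->] //.
move=> /(congr1 (@complex.Re R)) /=.
by move/mulfI; apply; rewrite oppr_eq0 pnatr_eq0.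
Qed.

End TwistorGeometry.

(** * Ricci type and the trace condition *)

Section RicciTypeInChart.
Context {R : realType} {n : nat} {M : manifold R (n + n)}.
Variables (w : symplectic_form M) (nabla : connection M).
Variables (c : chart R (n + n) M) (hc : atlas c).
Hypothesis torsion : torsion_free nabla.
Hypothesis preserves : preserves_form w nabla.
Variables (x : 'cV[R]_(n + n)) (cx : cimg c x).
Local Notation W := (sform w c x).
Local Notation K := (curvature_tensor nabla c x).
Implicit Types (X Y Z u v : 'cV[R]_(n + n)) (rho j : 'M[R]_(n + n)).

Let W_alt : forall u v, form W u v = - form W v u := sform_alt w hc cx.
Let W_unit : W \in unitmx := sform_unit w hc cx.
Let K_curv : symplectic_curvature W K :=
  curvature_tensor_curvature hc torsion preserves cx.

Lemma Ric_curvature_tensor u v :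
  Ric nabla c x u v = \tr (endo_mx (fun z => K u z *m v)).
Proof.
rewrite /Ric; congr (\tr (endo_mx _)).
by apply/funext => z; exact: (curvatureE nabla hc).
Qed.

Lemma Ricci_partE rho X Y Z :
  Ricci_part w nabla c x rho X Y Z = Ricci_tensor W K rho X Y Z.
Proof.
rewrite /Ricci_part /Ricci_tensor !Ric_curvature_tensor; congr (_ *: _).
by rewrite natrD; congr (_ / _); ring.
Qed.

Lemma chart_trace_Ricci j : compatible W j ->
  (forall j', compatible W j' -> forall X Y,
     \tr (curvature_mx nabla c x (j' *m X) (j' *m Y) *m j')
     = \tr (curvature_mx nabla c x X Y *m j')) ->
  exists rho, (forall X Y, form W (rho *m X) Y = Ric nabla c x X Y) /\
    (forall X Y Z, curvature nabla c x X Y Z = Ricci_part w nabla c x rho X Y Z).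
Proof.
move=> cj inv.
have [q qE] := Ric_form W_unit K_curv.
pose rho := (q *m invmx W)^T.
have rhoE X Y : form W (rho *m X) Y = \tr (endo_mx (fun z => K X z *m Y)).
  by rewrite form_mull /rho trmxK mulmxKV.
exists rho; split=> [X Y|X Y Z]; first by rewrite rhoE Ric_curvature_tensor.
rewrite (curvatureE nabla hc) // Ricci_partE.
apply: (trace_invariant_Ricci W_alt W_unit K_curv rhoE cj) => j' cj' X' Y'.
by have := inv j' cj' X' Y'; rewrite !(curvature_mxE nabla hc).
Qed.

Lemma chart_Ricci_trace rho j : compatible W j ->
  (forall X Y, form W (rho *m X) Y = Ric nabla c x X Y) ->
  (forall X Y Z, curvature nabla c x X Y Z = Ricci_part w nabla c x rho X Y Z) ->
  forall X Y, \tr (curvature_mx nabla c x (j *m X) (j *m Y) *m j)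
     = \tr (curvature_mx nabla c x X Y *m j).
Proof.
move=> cj rhoE KE X Y; rewrite !(curvature_mxE nabla hc) //.
have rhoE' u v : form W (rho *m u) v = \tr (endo_mx (fun z => K u z *m v)).
  by rewrite rhoE Ric_curvature_tensor.
have KE' u v z : K u v *m z = Ricci_tensor W K rho u v z.
  by rewrite -(curvatureE nabla hc) // KE Ricci_partE.
exact: (Ricci_trace_invariant W_alt W_unit K_curv rhoE' KE' cj).
Qed.

End RicciTypeInChart.

Theorem proposition6p12 (R : realType) (n : nat) (hn : (2 <= n)%N)
    (M : manifold R (n + n)) (w : symplectic_form M) (nabla : connection M)
    (hnabla : symplectic_connection w nabla) :
  [/\ type_1_1 w nabla 1 <-> trace_condition w nabla,
      type_1_1 w nabla (-1) <-> trace_condition w nabla &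
      (type_1_1 w nabla 1 /\ type_1_1 w nabla (-1)) <-> Ricci_type w nabla].
Proof.
have [torsion preserves] := hnabla.
have type_trace eps : eps ^+ 2 = 1 ->
    type_1_1 w nabla eps <-> trace_condition w nabla.
  move=> eps2; split=> [t11 E c x j hc tz X Y|tc c [x j] hc tz Xi Xi' t t'].
  - have v0 : vertical_at w c x j 0.
      by split; rewrite ?trmx0 !(mul0mx, mulmx0) addr0.
    have T X0 := twistor_tangentI hc preserves X0 tz v0.
    have := (twistor_form_Jnabla hc torsion preserves eps2 tz (T X) (T Y)).1
      (t11 c (x, j) hc tz _ _ (T X) (T Y)).
    exact.
  - by apply/(twistor_form_Jnabla hc torsion preserves eps2 tz t t'); apply: tc.
have trace_Ricci : trace_condition w nabla <-> Ricci_type w nabla.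
  split=> [tc c x hc cx|rt E c x j hc [/= cx cj] X Y].
  - have Wt := sform_tr w hc cx; have Wu := sform_unit w hc cx.
    have [a aW] := exists_symplectic_frame Wt Wu.
    apply: (chart_trace_Ricci hc torsion preserves cx (frame_compatible aW)).
    move=> j cj X Y; exact: (tc c x j hc (conj cx cj)).
  - have [rho [rhoE KE]] := rt c x hc cx.
    exact: (chart_Ricci_trace hc torsion preserves cx cj rhoE KE).
have t1 := type_trace 1 (expr1n _ _).
have tN1 : type_1_1 w nabla (-1) <-> trace_condition w nabla.
  by apply: type_trace; rewrite sqrrN expr1n.
split; [exact: t1|exact: tN1|split=> [[t _]|rt]].
  exact: (trace_Ricci.1 (t1.1 t)).
have tc := trace_Ricci.2 rt; exact: conj (t1.2 tc) (tN1.2 tc).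
Qed.
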